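(* Let $\alpha>1$, $c\in(0,\infty)$ and $v\in\mathfrak{D}_{\alpha,c}$. Let $(Z_n)_{n\ge0}$ be the random walk on $\mathbb{R}$ with i.i.d. symmetric increments having probability density $y\mapsto\frac12 v(|y|)$ on $\mathbb{R}$. For $a>0$ let $\tau_a:=\min\{n\ge0:|Z_n|\le a\}$, and let $x\notin[-a,a]$. (i) If $\alpha\ge2$, then $\mathbb{E}_x[\tau_a^q]<\infty$ if $q<1/2$ and $\mathbb{E}_x[\tau_a^q]=\infty$ if $q>1/2$. (ii) If $\alpha\in(1,2)$, then $\mathbb{E}_x[\tau_a^q]<\infty$ if $q<1-\frac1\alpha$ and $\mathbb{E}_x[\tau_a^q]=\infty$ if $q>1-\frac1\alpha$.
   Context: $\mathbb{R}_+=[0,\infty)$; $\min\emptyset:=+\infty$; $\mathbb{E}_x$ denotes expectation given $Z_0=x$. For a probability density $v:\mathbb{R}\to\mathbb{R}_+$ and $\alpha,c\in(0,\infty)$, write $v\in\mathfrak{D}_{\alpha,c}$ if there is a function $c(\cdot):\mathbb{R}_+\to(0,\infty)$ with $\sup_y c(y)<\infty$ and $\lim_{y\to\infty}c(y)=c$ such that $v(y)=c(y)y^{-1-\alpha}$ for $y>0$ and $v(y)=0$ for $y\le 0$. *)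

(* Defs.v *)
From HB Require Import structures.
From mathcomp Require Import all_boot all_order all_algebra.
From mathcomp Require Import finmap.
From mathcomp Require Import all_classical all_reals all_analysis.

Set Implicit Arguments.
Unset Strict Implicit.
Unset Printing Implicit Defensive.

Import Order.TTheory GRing.Theory Num.Theory.
Import numFieldNormedType.Exports.

Local Open Scope classical_set_scope.
Local Open Scope ring_scope.

Definition prob_density (R : realType) (v : R -> R) : Prop :=
  [/\ measurable_fun setT v,
      (forall y, 0 <= v y) &
      (\int[lebesgue_measure]_y (v y)%:E = 1)%E].

(* The class D_{alpha,c}.  The function c(.) lives on [0, +oo[; the values of
   [cf] on negative reals are unconstrained and never used. *)
Definition class_D (R : realType) (alpha c : R) (v : R -> R) : Prop :=
  prob_density v /\
  exists cf : R -> R,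
    [/\ (forall y, 0 <= y -> 0 < cf y),
        has_ubound (cf @` `[0, +oo[),
        cf y @[y --> +oo] --> c,
        (forall y, 0 < y -> v y = cf y * y `^ (- 1 - alpha)) &
        (forall y, y <= 0 -> v y = 0)].

Definition mutually_independent (R : realType) (d : measure_display)
    (T : measurableType d) (P : probability T R) (X : nat -> T -> R) : Prop :=
  forall (I : {fset nat}) (B : nat -> set R),
    (forall i, measurable (B i)) ->
    P (\bigcap_(i in [set` I]) (X i @^-1` B i)) =
    (\prod_(i <- I) P (X i @^-1` B i))%E.

Definition has_density (R : realType) (d : measure_display)
    (T : measurableType d) (P : probability T R) (X : T -> R) (f : R -> R)
    : Prop :=
  forall B : set R, measurable B ->
    P (X @^-1` B) = (\int[lebesgue_measure]_(y in B) (f y)%:E)%E.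

(* [Z] is a random walk with step density [f] under the law P = P_x. *)
Record random_walk (R : realType) (d : measure_display)
    (T : measurableType d) (P : probability T R) (f : R -> R) (x : R)
    (Z : nat -> {RV P >-> R}) : Prop := RandomWalk {
  random_walk_start : {ae P, forall w, Z 0%N w = x} ;
  random_walk_step : forall n, has_density P (fun w => Z n.+1 w - Z n w) f ;
  random_walk_indep : mutually_independent P (fun n w => Z n.+1 w - Z n w) }.

(* An infimum of naturals is a minimum, and [ereal_inf set0 = +oo]. *)
Definition hitting_time (R : realType) (T : Type) (Z : nat -> T -> R) (a : R)
    (w : T) : \bar R :=
  ereal_inf [set n%:R%:E | n in [set n : nat | `|Z n w| <= a]].

(* Beware that [poweR] sets (+oo) `^ q = +oo for q < 0 and (+oo) `^ 0 = 1.
   This only matters for q <= 0 on the event {tau_a = +oo}, and there it makes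
   finiteness of the moment at least as strong as with (+oo) `^ q = 0. *)
Definition hitting_moment (R : realType) (d : measure_display)
    (T : measurableType d) (P : probability T R) (Z : nat -> T -> R) (a q : R)
    : \bar R :=
  (\int[P]_w (hitting_time Z a w `^ q))%E.

(* Main.v *)
(* Let psi(t) = E(1 - cos tX) for a symmetric step X.  Since
   E cos(t(z + X)) = (1 - psi(t)) cos tz, the function
     h_w(z) = int_0^L w(t) (1 - cos tz) / psi(t) dt
   satisfies E h_w(z + X) = h_w(z) + int_0^L w(t) cos tz dt exactly.  With the
   tent w(t) = 1 - t/L the drift is the Fejer kernel (1 - cos Lz) / (L z^2).
   Let gamma = min(alpha, 2).  Up to arbitrarily small losses in the exponents,
   psi(t) is of order t^gamma at 0 and h of order |z|^(gamma - 1) at infinity.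

   Finite moments.  The difference of two normalised tents gives a nonnegative
   h, and summing its drift along the walk killed in [-a, a] shows that the
   killed walk spends a time at most C r in [-r, r], uniformly in the horizon;
   also E[h(Z_n); tau > n] stays bounded.  Hence
   n P(tau > n) <= C r + C n r^(1 - gamma), and r = n^(1/gamma) is optimal.

   Infinite moments.  h is subharmonic, so E[h(Z_n); tau > n] stays bounded away
   from 0 once the walk has made a first long jump.  If E tau^q were finite, then
   P(tau > n) <= C n^(-q), and the analogous potential of order |z|^s, s < gamma,
   whose drift is bounded, gives E[|Z_n|^s; tau > n] <= C n^(1 - q).
   Interpolating, E[h(Z_n); tau > n] <= C n^((gamma - 1) / gamma - q), up to
   epsilons, which tends to 0 for q > 1 - 1/gamma. *)

Require Import Defs.
From HB Require Import structures.
From mathcomp Require Import all_boot all_order all_algebra.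
From mathcomp Require Import finmap interval_inference.
From mathcomp Require Import all_classical all_reals all_analysis measurable_realfun.
From mathcomp Require Import ring lra.
Set Implicit Arguments.
Unset Strict Implicit.
Unset Printing Implicit Defensive.
Import Order.TTheory GRing.Theory Num.Theory.
Import numFieldNormedType.Exports.
Local Open Scope classical_set_scope.
Local Open Scope ring_scope.

(** * Elementary estimates *)

(** Steps can jump over the interval, so the walk may change sign before it hits, and one-sided
    fluctuation theory does not apply directly; exact identities for potentials take its place. The
    tent is preferred to a sharp cutoff because the cosine transform of an indicator, sin(Lz)/z,
    changes sign and decays slowly, whereas that of the tent is nonnegative and at most 2/(L z^2).
    In the finite case the obstacle is that this kernel still pushes the potential up. Its total
    along the killed walk is controlled by the expected sum of 1/z^2, which splits into dyadic rings
    whose occupation times are bounded by that same total. The circle closes with a factor 1/2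
    because the cost carries the factor 2/L and L is large compared with 1/a. Exponents are lost in
    the upper bound on psi, obtained from E|X|^b with b < alpha, and in the upper bound on h, where
    integrability at 0 forces an exponent above gamma - 1. The lower bound on psi is lossless, and
    the strict inequalities on q absorb the rest. *)

Section trigonometric_bounds.
Context (R : realType).
Implicit Types (u z t : R).

Lemma normr_sin_le u : `|sin u| <= `|u|.
Proof.
wlog u0 : u / 0 <= u.
  move=> h; have [/h//|u0] := leP 0 u.
  by rewrite -normrN -sinN -[leRHS]normrN h// oppr_ge0 ltW.
have [v _] : exists2 v, v \in `[0, u] & sin u - sin 0 = cos v * (u - 0).
  apply: (@MVT_segment R sin cos) => //.
  by apply: continuous_subspaceT => w; exact: continuous_sin.
by rewrite sin0 !subr0 => ->; rewrite normrM ler_piMl// cos_max.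
Qed.

Lemma one_minus_cos_sin u : 1 - cos u = 2 * sin (u / 2) ^+ 2.
Proof.
have {1}-> : u = (u / 2) *+ 2 by rewrite -[_ *+ 2]mulr_natr mulfVK.
by rewrite cos_mulr2n cos2sin2; ring.
Qed.

Lemma one_minus_cos_le2 u : 1 - cos u <= 2.
Proof. by have := cos_geN1 u; lra. Qed.

Lemma one_minus_cos_ge0 u : 0 <= 1 - cos u.
Proof. by rewrite subr_ge0 cos_le1. Qed.

Lemma one_minus_cos_le_sqr u : 1 - cos u <= u ^+ 2 / 2.
Proof.
rewrite one_minus_cos_sin -(real_normK (num_real (sin _))).
have : `|sin (u / 2)| ^+ 2 <= `|u / 2| ^+ 2.
  by rewrite ler_sqr ?nnegrE// normr_sin_le.
by rewrite !real_normK ?num_real//; lra.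
Qed.

Lemma one_minus_cos_ge_sqr u : `|u| <= 1 -> u ^+ 2 / 4 <= 1 - cos u.
Proof.
move=> u1.
wlog u0 : u u1 / 0 <= u.
  move=> h; have [/h->//|u0] := leP 0 u.
  by rewrite -sqrrN -cosN h ?normrN// oppr_ge0 ltW.
rewrite one_minus_cos_sin.
have [v /[!in_itv]/= /andP[v0 vu]] :
    exists2 v, v \in `[0, u / 2] & sin (u / 2) - sin 0 = cos v * (u / 2 - 0).
  apply: (@MVT_segment R sin cos); first by rewrite divr_ge0.
  by apply: continuous_subspaceT => w; exact: continuous_sin.
rewrite sin0 !subr0 => ->.
have := one_minus_cos_le_sqr v.
rewrite ger0_norm// in u1.
have v2 : v <= 2^-1 by lra.
have vv : v ^+ 2 <= 2^-1 * 2^-1 by rewrite expr2 ler_pM.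
(* The mean value point satisfies v <= 1/2, so cos v >= 1 - v^2/2 >= 7/8, and (7/8)^2 / 2 exceeds
   1/4. *)
move=> cv; have {}cv : 7 / 8 <= cos v by lra.
have : (7 / 8) ^+ 2 <= cos v ^+ 2 by rewrite ler_sqr ?nnegrE//; lra.
move=> h; rewrite exprMn; have := ler_wpM2r (sqr_ge0 u) h; nra.
Qed.

(** Interpolates between the bounds 2 and u^2/2. The free exponent is what later trades growth in z
    against integrability at t = 0. *)
Lemma one_minus_cos_le_powR u (th : R) : 0 <= th <= 2 ->
  1 - cos u <= 2 * `|u| `^ th.
Proof.
move=> /andP[th0 th2].
have [u1|u1] := leP `|u| 1; last first.
  apply: (le_trans (one_minus_cos_le2 _)); rewrite ler_peMr//.
  by rewrite -(powRr0 `|u|) ler_powR// ltW.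
have [->|u0] := eqVneq u 0.
  by rewrite cos0 subrr mulr_ge0 ?powR_ge0.
apply: (le_trans (one_minus_cos_le_sqr _)).
have : `|u| `^ 2 <= `|u| `^ th by rewrite ger_powR// normr_gt0 u0.
rewrite (powR_mulrn 2)// real_normK ?num_real//; have := sqr_ge0 u; lra.
Qed.

Lemma FTC2_continuous (f F : R -> R) (a b : R) : a < b -> continuous f ->
  (forall x : R, is_derive x (1 : R) F (f x)) ->
  (\int[lebesgue_measure]_(x in `[a, b]) (f x)%:E = (F b - F a)%:E)%E.
Proof.
move=> ab cf dF.
have cF : continuous F.
  move=> x; apply: differentiable_continuous.
  by apply/derivable1_diffP; case: (dF x).
rewrite (@continuous_FTC2 R f F a b ab) ?EFinB//.
- exact: continuous_subspaceT.
- split.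
  + by move=> x _; case: (dF x).
  + exact/cvg_at_right_filter/cF.
  + exact/cvg_at_left_filter/cF.
- by move=> x _; rewrite derive1E; case: (dF x).
Qed.

Lemma is_derive_sinM z t : is_derive t 1 (fun t => sin (t * z)) (z * cos (t * z)).
Proof.
have d : is_derive t 1 (fun t : R => t * z) z.
  by apply: is_derive_eq; rewrite scaler0 add0r /GRing.scale/= mulr1.
by rewrite mulrC; apply: (@is_derive1_comp R sin (fun t => t * z)).
Qed.

Lemma is_derive_cosM z t : is_derive t 1 (fun t => cos (t * z)) (- z * sin (t * z)).
Proof.
have d : is_derive t 1 (fun t : R => t * z) z.
  by apply: is_derive_eq; rewrite scaler0 add0r /GRing.scale/= mulr1.
rewrite mulrC mulrN -mulNr.
by apply: (@is_derive1_comp R cos (fun t => t * z)).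
Qed.

Lemma continuous_cosM z : continuous (fun t : R => cos (t * z)).
Proof.
move=> t; apply: differentiable_continuous; apply/derivable1_diffP.
by case: (is_derive_cosM z t).
Qed.

Lemma integral_fejer (L z : R) : 0 < L -> z != 0 ->
  (\int[lebesgue_measure]_(t in `[0%R, L]) ((1 - t / L) * cos (t * z))%:E =
   ((1 - cos (L * z)) / (L * z ^+ 2))%:E)%E.
Proof.
move=> L0 z0; have L1 := lt0r_neq0 L0.
(* Antiderivative from one integration by parts; its sine term vanishes at both ends, through 1 -
   t/L at L and through the sine at 0. *)
pose F t := (1 - t / L) * (z^-1 * sin (t * z)) - (L * z ^+ 2)^-1 * cos (t * z).
have dF (t : R) : is_derive t (1 : R) F ((1 - t / L) * cos (t * z)).
  rewrite /F; have ds := is_derive_sinM z t; have dc := is_derive_cosM z t.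
  apply: is_derive_eq; rewrite /GRing.scale/=.
  by field; rewrite ?z0 ?L1.
rewrite (FTC2_continuous L0 _ dF)//.
  congr EFin; rewrite /F divff// subrr !mul0r sin0 !mulr0 cos0.
  by field; rewrite ?z0 ?L1.
move=> t; apply: cvgM; last exact: continuous_cosM.
by apply: cvgB; [exact: cvg_cst|apply: cvgM; [exact: cvg_id|exact: cvg_cst]].
Qed.

Lemma integral_one_minus_cos (t a b : R) : 0 < t -> a < b ->
  (\int[lebesgue_measure]_(y in `[a, b]) (1 - cos (y * t))%:E =
   (b - a - (sin (b * t) - sin (a * t)) / t)%:E)%E.
Proof.
move=> t0 ab.
have dF (y : R) :
    is_derive y (1 : R) (fun y => y - t^-1 * sin (y * t)) (1 - cos (y * t)).
  have ds := is_derive_sinM t y.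
  apply: is_derive_eq; rewrite /GRing.scale/=.
  by field; rewrite gt_eqF.
rewrite (FTC2_continuous ab _ dF).
  by congr EFin; ring.
by move=> y; apply: cvgB; [exact: cvg_cst|exact: continuous_cosM].
Qed.

End trigonometric_bounds.

(** * Dyadic estimates of moments *)

Lemma powRN_decay (R : realType) (K r p : R) : 0 <= K -> 0 < r -> 0 < p ->
  exists2 n : nat, (0 < n)%N & K * n%:R `^ (- p) < r.
Proof.
move=> K0 r0 p0; pose z := ((K + 1) / r) `^ p^-1.
have zn := truncnS_gt z; exists (Num.truncn z).+1 => //.
set n := (Num.truncn z).+1 in zn *.
have n0 : 0 < n%:R :> R by rewrite ltr0n.
have big : (K + 1) / r <= n%:R `^ p.
  have -> : (K + 1) / r = z `^ p.
    by rewrite -powRrM mulVf ?gt_eqF// powRr1// divr_ge0 ?addr_ge0// ltW.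
  by rewrite ge0_ler_powR ?nnegrE ?powR_ge0 ?(ltW p0)// ltW.
rewrite powRN ltr_pdivrMr ?powR_gt0// mulrC.
by rewrite ler_pdivrMr// in big; apply: lt_le_trans big; rewrite ltrDl.
Qed.

Section dyadic_decomposition.
Context (R : realType).

Lemma dyadic_shell (y : R) : 1 < y -> exists j : nat, 2 ^+ j < y <= 2 ^+ j.+1.
Proof.
move=> y1.
have ex : exists j, y <= 2 ^+ j.
  exists (Num.truncn y).+1; rewrite ltW// (lt_le_trans (truncnS_gt y))//.
  by rewrite -natrX ler_nat ltnW// ltn_expl.
case: (ex_minnP ex) => -[|j] yj jmin.
  by move: yj; rewrite expr0 leNgt y1.
exists j; rewrite yj andbT ltNge; apply/negP => /jmin.
by rewrite ltnn.
Qed.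

Lemma nneseries_geometric_lty (K r : R) : 0 <= K -> 0 <= r < 1 ->
  (\sum_(0 <= j <oo) (K * r ^+ j)%:E < +oo)%E.
Proof.
move=> K0 /andP[r0 r1].
have h n : (0 <= n)%N -> xpredT n -> (0 <= (K * r ^+ n)%:E)%E.
  by move=> _ _; rewrite lee_fin mulr_ge0// exprn_ge0.
apply: (@le_lt_trans _ _ (K / (1 - r))%:E); last exact: ltry.
apply: lime_le; first exact: is_cvg_nneseries.
near=> n; rewrite sumEFin lee_fin.
rewrite -[X in X <= _]/(series (geometric K r) n) geometric_seriesE ?lt_eqF//=.
rewrite ler_pM2r ?invr_gt0 ?subr_gt0// ler_piMr// gerBl exprn_ge0//.
Unshelve. all: by end_near. Qed.

Context d (T : measurableType d) (mu : {measure set T -> \bar R}).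
Variables (D : set T) (Y : T -> R) (C p q : R).
Hypothesis mD : measurable D.
Hypothesis mY : measurable_fun D Y.
Hypothesis Y0 : forall w, D w -> 0 <= Y w.
Hypothesis muD : (mu D < +oo)%E.
Hypothesis C0 : 0 <= C.
Hypothesis q0 : 0 <= q.
Hypothesis qp : q < p.
Hypothesis shell : forall j : nat,
  (mu (D `&` [set w | 2 ^+ j < Y w <= 2 ^+ j.+1]%R) <=
   (C * (2 ^+ j) `^ (- p))%:E)%E.

(** On the shell of index j the integrand is at most (2^(j+1))^q and the mass at most C 2^(-jp),
    which gives a geometric series of ratio 2^(q-p) < 1; the set Y <= 1 contributes at most the mass
    of D. It serves for singular integrals at 0, for moments of the step and for moments of the
    hitting time. *)
Lemma dyadic_moment : (\int[mu]_(w in D) (Y w `^ q)%:E < +oo)%E.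
Proof.
pose E (j : nat) := D `&` [set w | 2 ^+ j < Y w <= 2 ^+ j.+1].
have mE j : measurable (E j).
  rewrite (_ : E j = D `&` Y @^-1` `]2 ^+ j, 2 ^+ j.+1]); first exact: mY.
  by apply/seteqP; split => w [Dw] /=; rewrite in_itv.
pose g (j : nat) w : \bar R := ((2 ^+ j.+1) `^ q * \1_(E j) w)%:E.
have g0 j w : (0 <= g j w)%E by rewrite lee_fin mulr_ge0// powR_ge0.
have mg j : measurable_fun D (g j).
  by apply/measurable_EFinP; apply: measurable_funM.
have le1 w : D w -> ((Y w `^ q)%:E <= 1%:E + \sum_(0 <= j <oo) g j w)%E.
  move=> Dw; have [Y1|/dyadic_shell[j /andP[jY Yj]]] := leP (Y w) 1.
    apply: (@le_trans _ _ 1%:E).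
      rewrite lee_fin (_ : 1 = 1 `^ q); last by rewrite powR1.
      by rewrite ge0_ler_powR ?nnegrE ?Y0.
    by rewrite leeDl// nneseries_ge0.
  apply: (@le_trans _ _ (g j w)).
    rewrite /g indicE mem_set ?mulr1; last by split => //; apply/andP.
    by rewrite lee_fin ge0_ler_powR ?nnegrE ?Y0 ?exprn_ge0.
  apply: (@le_trans _ _ (\sum_(0 <= i < j.+1) g i w)%E).
    by rewrite big_nat_recr//= leeDr// sume_ge0.
  apply: (@le_trans _ _ (\sum_(0 <= j <oo) g j w)%E).
    exact: nneseries_lim_ge.
  by rewrite leeDr.
apply: (@le_lt_trans _ _ (\int[mu]_(w in D) (1%:E + \sum_(0 <= j <oo) g j w))%E).
  apply: ge0_le_integral => //.
  - by move=> w _; rewrite lee_fin powR_ge0.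
  - by apply/measurable_EFinP; exact: (measurableT_comp (measurable_powR q) mY).
  - by apply: emeasurable_funD => //; exact: ge0_emeasurable_sum.
rewrite ge0_integralD//; last 2 first.
- by move=> w _; exact: nneseries_ge0.
- exact: ge0_emeasurable_sum.
rewrite lte_add_pinfty//; first by rewrite integral_cst// mul1e.
rewrite integral_nneseries//.
pose K := 2 `^ q * C.
pose r : R := 2 `^ (q - p).
apply: (@le_lt_trans _ _ (\sum_(0 <= j <oo) (K * r ^+ j)%:E)%E); last first.
  apply: nneseries_geometric_lty; first by rewrite mulr_ge0// powR_ge0.
  rewrite powR_ge0/= /r /powR pnatr_eq0/= expR_lt1.
  by rewrite nmulr_rlt0 ?subr_lt0// ln_gt0 ?ltr1n.
apply: lee_nneseries.
  by move=> j _ _; apply: integral_ge0.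
move=> j _; rewrite /g.
under eq_integral do rewrite EFinM.
have k0 : (0 <= ((2 ^+ j.+1) `^ q)%:E :> \bar R)%E by rewrite lee_fin powR_ge0.
rewrite ge0_integralZl//; last exact/measurable_EFinP.
rewrite integral_indic// (_ : E j `&` D = E j); last first.
  by apply: setIidl => w [].
apply: (@le_trans _ _ (((2 ^+ j.+1) `^ q)%:E * (C * (2 ^+ j) `^ (- p))%:E)%E).
  by apply: lee_pmul => //; exact: shell.
rewrite -EFinM lee_fin /K /r exprS powRM ?exprn_ge0//.
rewrite -!(powR_mulrn j)// -?powRrM ?powR_ge0//.
have -> : 2 `^ ((q - p) * j%:R) = 2 `^ (j%:R * q) * 2 `^ (j%:R * - p) :> R.
  rewrite -powRD; last by rewrite pnatr_eq0 implybT.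
  by congr (_ `^ _); ring.
by rewrite le_eqVlt; apply/orP; left; apply/eqP; ring.
Qed.

End dyadic_decomposition.

Section singular_integral.
Context (R : realType).
Local Notation leb := (@lebesgue_measure R).

Lemma integral_inv_powR_lty (L k : R) : 0 < L -> k < 1 ->
  (\int[leb]_(t in `]0%R, L]) (t `^ (- k))%:E < +oo)%E.
Proof.
move=> L0 k1.
wlog k0 : k k1 / 0 <= k.
  move=> h; have [/h->//|k0] := leP 0 k.
  apply: (@le_lt_trans _ _ (\int[leb]_(t in `]0%R, L]) (cst (L `^ (- k))%:E) t)%E).
    apply: ge0_le_integral => //.
    - by move=> t _; rewrite lee_fin powR_ge0.
    - apply/measurable_EFinP; apply: measurable_funTS; exact: measurable_powR.
    - move=> t /=; rewrite in_itv/= => /andP[t0 tL]; rewrite lee_fin.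
      by rewrite ge0_ler_powR ?nnegrE ?(ltW t0) ?(ltW L0)// oppr_ge0 ltW.
  by rewrite integral_cst//= lebesgue_measure_itv/= lte_fin L0 -EFinB -EFinM ltry.
have : (\int[leb]_(t in `]0%R, L]) ((t `^ (-1)) `^ k)%:E < +oo)%E.
  (* Applied to Y = 1/t: its shell of index j lies in ]0, 2^-j], so the tail exponent is 1 and k < 1
     is the condition. *)
  apply: (@dyadic_moment _ _ _ _ _ _ 1 1) => //.
  - by apply: measurable_funTS; exact: measurable_powR.
  - by move=> t _; exact: powR_ge0.
  - have : (leb `]0%R, L] < +oo)%E.
      by rewrite lebesgue_measure_itv/= lte_fin L0 -EFinB ltry.
    by [].
  - move=> j.
    apply: (@le_trans _ _ (leb `]0%R, (2 ^+ j)^-1])).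
      apply: le_measure; rewrite ?inE//.
        rewrite (_ : _ `&` _ = `]0, L] `&` (fun t : R => t `^ (-1)) @^-1` `]2 ^+ j, 2 ^+ j.+1]).
          by apply: measurable_funTS => //; exact: measurable_powR.
        by apply/seteqP; split => t [/=]; rewrite !in_itv/=.
      move=> t [/=]; rewrite !in_itv/= => /andP[t0 _].
      rewrite powR_inv1 ?(ltW t0)// => /andP[jt _].
      rewrite t0/= ltW//; move: jt; rewrite -[X in _ < X -> _]div1r.
      by rewrite ltr_pdivlMr// mulrC -ltr_pdivlMr ?exprn_gt0// div1r; apply.
    have -> : leb `]0%R, (2 ^+ j)^-1] = ((2 ^+ j)^-1)%:E.
      by rewrite lebesgue_measure_itv/= lte_fin invr_gt0 exprn_gt0// oppr0 adde0.
    by rewrite lee_fin mul1r powR_inv1// exprn_ge0.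
congr (_ < _)%E; apply: eq_integral => t; rewrite inE/= in_itv/= => /andP[t0 _].
by rewrite -powRrM mulN1r.
Qed.

End singular_integral.

(** * The killed random walk *)

Section killed_walk.
Context (R : realType) (d : measure_display) (T : measurableType d).
Variables (P : probability T R) (X : nat -> T -> R) (mu : probability R R).
Hypothesis mX : forall n, measurable_fun setT (X n).
Hypothesis indX : mutually_independent P X.
Hypothesis lawX : forall n B, measurable B -> P (X n @^-1` B) = mu B.

Definition cylinder n : set (set T) :=
  [set A | exists2 B : nat -> set R, (forall i, measurable (B i)) &
     A = \bigcap_(i in [set i | (i < n)%N]) (X i @^-1` B i)].

(* [pastT n] is [T] with the sigma-algebra of the first [n] steps: independence
   means that [(id, X n)] has a product law on [pastT n * R]. *)
Let pastT n : measurableType (cylinder n).-sigma :=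
  g_sigma_algebraType (cylinder n).

Lemma measurable_preimageX i B : measurable B -> measurable (X i @^-1` B).
Proof. by move=> mB; rewrite -[X in measurable X]setTI; exact: mX. Qed.

Lemma cylinder_measurable n : cylinder n `<=` @measurable d T.
Proof.
move=> _ [B mB ->]; apply: bigcap_measurableType => i _.
exact: measurable_preimageX.
Qed.

Lemma setI_closed_cylinder n : setI_closed (cylinder n).
Proof.
move=> _ _ [B mB ->] [C mC ->]; exists (fun i => B i `&` C i).
  by move=> i; exact: measurableI.
by rewrite -bigcapI; apply: eq_bigcapr => i _; rewrite preimage_setI.
Qed.

Lemma past_measurable n : <<s cylinder n >> `<=` @measurable d T.
Proof.
apply: smallest_sub => //; last exact: cylinder_measurable.
exact: sigma_algebra_measurable.
Qed.

(** For fixed C both sides are finite measures in A, a restriction and a multiple of P; they agree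
    on the cylinders, which are stable under intersection and generate the past. *)
Lemma past_independent n A C : <<s cylinder n >> A -> measurable C ->
  P (A `&` X n @^-1` C) = (P A * mu C)%E.
Proof.
move=> sA mC.
have mXC := measurable_preimageX n mC.
pose m1 : {measure set T -> \bar R} := mrestr P mXC.
have muC0 : 0 <= fine (mu C) by rewrite fine_ge0.
pose m2 : {measure set T -> \bar R} := mscale (NngNum muC0) P.
have -> : P (A `&` X n @^-1` C) = m1 A by [].
have muCE : (fine (mu C))%:E = mu C by rewrite fineK// fin_num_measure.
have -> : (P A * mu C)%E = m2 A by rewrite /= /mscale/= muCE muleC.
apply: (g_sigma_algebra_measure_unique (cylinder n) _ (fun=> setT)) => //.
- exact: cylinder_measurable.
- move=> _; exists (fun=> setT) => //.
  by apply/seteqP; split.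
- by rewrite bigcup_const//; exists 0%N.
- exact: setI_closed_cylinder.
- move=> _ [B mB ->].
  rewrite /= /mrestr /mscale /= muCE.
  (* Independence of n + 1 steps, with C as target of the last one, and of n steps: the two products
     differ by the factor mu C. *)
  have := @indX [fset i | i in iota 0 n.+1]%fset
    (fun i => if i == n then C else B i).
  have := @indX [fset i | i in iota 0 n]%fset B mB.
  have seqE m : [fset i | i in iota 0 m]%fset =i iota 0 m.
    by move=> i; rewrite inE.
  have pE m (F : nat -> \bar R) :
    (\prod_(i <- [fset i | i in iota 0 m]%fset) F i =
     \prod_(i < m) F i)%E.
    rewrite -(big_mkord xpredT) /index_iota subn0.
    apply: perm_big; apply: uniq_perm => //; first exact: iota_uniq.
    by move=> i; rewrite seqE.
  have bE m (F : nat -> set T) :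
    \bigcap_(i in [set` [fset i | i in iota 0 m]%fset]) F i =
    \bigcap_(i in [set i | (i < m)%N]) F i.
    congr bigcap; apply/seteqP; split => i /=; rewrite seqE mem_iota //.
  rewrite !pE !bE => PB PBC.
  rewrite PB.
  rewrite big_ord_recr/= eqxx lawX// in PBC.
  have -> : \bigcap_(i in [set i | (i < n)%N]) X i @^-1` B i `&` X n @^-1` C
    = \bigcap_(i in [set i | (i < n.+1)%N]) X i @^-1` (if i == n then C else B i).
    apply/seteqP; split.
      move=> w [h1 h2] i /= ; rewrite ltnS leq_eqVlt => /orP[/eqP ->|ilt].
        by rewrite eqxx.
      by rewrite (ltn_eqF ilt); exact: h1.
    move=> w h; split.
      move=> i /= ilt; have := h i (ltnW ilt).
      by rewrite (ltn_eqF ilt).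
    by have := h n (ltnSn n); rewrite eqxx.
  rewrite PBC; last by move=> i; case: ifP.
  rewrite muleC; congr (_ * _)%E; apply: eq_bigr => i _.
  by rewrite (ltn_eqF (ltn_ord i)).
- by move=> k; rewrite (le_lt_trans (probability_le1 _ _)) ?ltry//= /mrestr setTI.
Qed.

(** The form of the Markov property used here: G may depend on the whole past, and the next step is
    integrated out under its own law. *)
Lemma past_fubini_tonelli n (G : T -> R -> \bar R) :
  (forall w y, 0 <= G w y)%E ->
  measurable_fun [set: (pastT n * R)%type] (fun z => G z.1 z.2) ->
  (\int[P]_w G w (X n w) = \int[P]_w \int[mu]_y G w y)%E.
Proof.
move=> G0 mG.
pose toPast : T -> pastT n := id.
have mid : measurable_fun setT toPast.
  by move=> _ A mA; rewrite setTI; exact: past_measurable mA.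
pose idm : {mfun T >-> pastT n} := HB.pack toPast (isMeasurableFun.Build _ _ _ _ _ mid).
pose Q := distribution P idm.
have mW : measurable_fun setT (fun w => (toPast w, X n w) : pastT n * R).
  exact: measurable_fun_pair.
pose W : {mfun T >-> (pastT n * R)%type} := HB.pack
  (fun w => (toPast w, X n w) : pastT n * R) (isMeasurableFun.Build _ _ _ _ _ mW).
pose H : pastT n * R -> \bar R := fun z => G z.1 z.2.
have H0 z : (0 <= H z)%E by exact: G0.
transitivity (\int[distribution P W]_z H z)%E.
  by rewrite ge0_integral_distribution.
transitivity (\int[(Q \x mu)%E]_z H z)%E.
  apply: eq_measure_integral => /= A mA _.
  apply/esym/product_measure_unique => // B C mB mC.
  rewrite /distribution/= /pushforward/= -(past_independent mB mC).
  by congr (P _); apply/seteqP; split.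
rewrite fubini_tonelli1//.
rewrite ge0_integral_distribution//; last by move=> y; apply: integral_ge0.
exact: measurable_fun_fubini_tonelli_F.
Qed.

Variables (x : R) (D : nat -> set R).
Hypothesis mD : forall n, measurable (D n).

Definition walk n w := x + \sum_(i < n) X i w.

(** The domain may vary with time: the upper bound on survival uses a constant one, the lower bound
    a stricter one at time 1. *)
Definition alive n := [set w | forall k, (k <= n)%N -> D k (walk k w)].

Lemma walkS n w : walk n.+1 w = walk n w + X n w.
Proof. by rewrite /walk big_ord_recr/= addrA. Qed.

Lemma measurable_walk_past n k : (k <= n)%N ->
  measurable_fun setT (walk k : pastT n -> R).
Proof.
move=> kn; apply: measurable_funD; first exact: measurable_cst.
apply: measurable_sum => i; move=> _ B mB.
rewrite setTI; apply: sub_sigma_algebra.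
exists (fun j : nat => if j == i :> nat then B else setT); first by move=> j; case: ifP.
apply/seteqP; split.
  by move=> w Bw j _; case: eqP => // ->.
move=> w /(_ i); rewrite /= eqxx; apply.
exact: leq_trans (ltn_ord i) kn.
Qed.

Lemma measurable_walk n : measurable_fun setT (walk n).
Proof.
apply: measurable_funD; first exact: measurable_cst.
exact: measurable_sum.
Qed.

Lemma aliveE n :
  alive n = \bigcap_(k in [set k | (k <= n)%N]) walk k @^-1` D k.
Proof. by []. Qed.

Lemma alive_past n : @measurable _ (pastT n) (alive n).
Proof.
rewrite aliveE; apply: bigcap_measurableType => k kn.
by rewrite -[X in measurable X]setTI; exact: measurable_walk_past.
Qed.

Lemma measurable_alive n : measurable (alive n).
Proof. by apply: (@past_measurable n); exact: alive_past. Qed.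

Lemma aliveS n : alive n.+1 = alive n `&` walk n.+1 @^-1` D n.+1.
Proof.
apply/seteqP; split => w.
  by move=> h; split=> [k kn|]; apply: h => //; exact: leqW.
move=> [h1 h2] k; rewrite leq_eqVlt => /orP[/eqP ->//|]; rewrite ltnS; exact: h1.
Qed.

Lemma integral_alive_step n (g : R -> \bar R) :
  (forall y, 0 <= g y)%E -> measurable_fun setT g ->
  (\int[P]_(w in alive n) g (walk n.+1 w) =
   \int[P]_(w in alive n) \int[mu]_y g (walk n w + y)%R)%E.
Proof.
move=> g0 mg.
have mA := measurable_alive n.
rewrite [LHS]integral_mkcond [RHS]integral_mkcond.
pose G w y := ((\1_(alive n) w)%:E * g (walk n w + y)%R)%E.
have G0 w y : (0 <= G w y)%E by apply: mule_ge0 => //; rewrite lee_fin.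
transitivity (\int[P]_w G w (X n w))%E.
  apply: eq_integral => w _; rewrite /G patchE indicE walkS.
  by case: ifP; rewrite ?mul1e ?mul0e.
rewrite past_fubini_tonelli//; last first.
  apply: emeasurable_funM.
    apply/measurable_EFinP.
    apply: (@measurableT_comp _ _ _ _ (pastT n) _ (\1_(alive n) : pastT n -> R)).
      exact: measurable_indic (@alive_past n).
    by [].
  apply: measurableT_comp => //; apply: measurable_funD => //.
  apply: (measurableT_comp (measurable_walk_past (leqnn n))) => //.
apply: eq_integral => w _; rewrite /G patchE indicE; case: ifP => _.
  by apply: eq_integral => y _; rewrite mul1e.
by under eq_integral do rewrite mul0e; rewrite integral0.
Qed.

End killed_walk.

(** * Potentials *)

Section spectral_potential.
Context (R : realType) (mu : probability R R).
Hypothesis mu_sym : forall B : set R, measurable B -> mu (-%R @^-1` B) = mu B.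
Local Notation leb := (@lebesgue_measure R).

Lemma integral_reflect (g : R -> \bar R) :
  (forall y, 0 <= g y)%E -> measurable_fun setT g ->
  (\int[mu]_y g (- y)%R = \int[mu]_y g y)%E.
Proof.
move=> g0 mg; transitivity (\int[pushforward mu (-%R : R -> R)]_y g y)%E.
  by rewrite ge0_integral_pushforward.
by apply: eq_measure_integral => A mA _; exact: mu_sym.
Qed.

(** The psi of the overview. Taking [fine] loses nothing, since the integrand lies between 0 and
    2. *)
Definition one_minus_cf (t : R) : R := fine (\int[mu]_y (1 - cos (t * y))%:E)%E.

Lemma measurable_cosM (t : R) : measurable_fun setT (fun y : R => cos (t * y)).
Proof.
apply: measurableT_comp; last exact: mulrl_measurable.
by apply: continuous_measurable_fun; exact: continuous_cos.
Qed.

Lemma measurable_cos2 : measurable_fun setT (fun z : R * R => cos (z.1 * z.2)).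
Proof.
apply: measurableT_comp; last exact: measurable_funM.
by apply: continuous_measurable_fun; exact: continuous_cos.
Qed.

Lemma integrable_one_minus_cos (t : R) :
  mu.-integrable setT (fun y => (1 - cos (t * y))%:E).
Proof.
apply: measurable_bounded_integrable => //.
- by rewrite (le_lt_trans (probability_le1 _ _)) ?ltry.
- exact: measurable_funB (measurable_cosM t).
- exists 2; split => // M M2 y _ /=.
  rewrite ger0_norm ?subr_ge0 ?cos_le1//.
  by have := cos_geN1 (t * y); lra.
Qed.

Lemma one_minus_cfE t :
  (\int[mu]_y (1 - cos (t * y))%:E = (one_minus_cf t)%:E)%E.
Proof. by rewrite /one_minus_cf fineK// integrable_fin_num// integrable_one_minus_cos. Qed.

Lemma measurable_one_minus_cf : measurable_fun setT one_minus_cf.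
Proof.
apply: measurableT_comp => //.
pose F (z : R * R) := (1 - cos (z.1 * z.2))%:E.
apply: (@measurable_fun_fubini_tonelli_F _ _ _ _ _ mu F).
  apply/measurable_EFinP; apply: measurable_funB => //; exact: measurable_cos2.
by move=> z; rewrite lee_fin subr_ge0 cos_le1.
Qed.

Lemma one_minus_cf_ge0 t : 0 <= one_minus_cf t.
Proof.
by rewrite fine_ge0// integral_ge0// => y _; rewrite lee_fin subr_ge0 cos_le1.
Qed.

Lemma integral_one_minus_cos_shift (t z : R) :
  (\int[mu]_y (1 - cos (t * (z + y)))%:E =
   (1 - cos (t * z) + one_minus_cf t * cos (t * z))%:E)%E.
Proof.
pose f y : R := 1 - cos (t * (z + y)).
have f0 y : 0 <= f y by rewrite subr_ge0 cos_le1.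
have mf : measurable_fun setT f.
  apply: measurable_funB => //.
  apply: (measurableT_comp (measurable_cosM t)).
  by apply: measurable_funD.
have If : (\int[mu]_y (f (- y))%:E = \int[mu]_y (f y)%:E)%E.
  apply: (integral_reflect (g := EFin \o f)) => //.
  exact/measurable_EFinP.
have mfN : measurable_fun setT (fun y : R => f (- y)) by exact: measurableT_comp.
(* Adding the integrals at y and -y, equal by symmetry, cancels the sine terms. *)
have : (\int[mu]_y (f y)%:E + \int[mu]_y (f y)%:E =
  \int[mu]_y (2 * (1 - cos (t * z)) + 2 * cos (t * z) * (1 - cos (t * y)))%:E)%E.
  rewrite -{2}If -ge0_integralD//; last first.
  - exact/measurable_EFinP.
  - by move=> y _; rewrite lee_fin.
  - exact/measurable_EFinP.
  - by move=> y _; rewrite lee_fin.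
  apply: eq_integral => y _; rewrite -EFinD /f !mulrDr mulrN !cosD sinN cosN.
  by congr EFin; ring.
have -> : (\int[mu]_y (2 * (1 - cos (t * z)) +
      2 * cos (t * z) * (1 - cos (t * y)))%:E =
    (2 * (1 - cos (t * z)) + 2 * cos (t * z) * one_minus_cf t)%:E)%E.
  under eq_integral do rewrite EFinD EFinM.
  rewrite integralD//.
  - rewrite integral_cst// [X in (_ * X + _)%E](_ : _ = 1%E) ?mule1; last exact: probability_setT.
    rewrite EFinD; congr (_ + _)%E.
    under eq_integral do rewrite EFinM.
    rewrite integralZl//; last exact: integrable_one_minus_cos.
    by rewrite one_minus_cfE EFinM.
  - by apply: finite_measure_integrable_cst.
  - under eq_fun do rewrite EFinM.
    by apply: integrableZl => //; exact: integrable_one_minus_cos.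
set I := (\int[mu]_y (f y)%:E)%E.
(* The integral is nonnegative and its double is finite, so it is a real number and can be
   halved. *)
have I0 : (0 <= I)%E by apply: integral_ge0 => y _; rewrite lee_fin.
case: I I0 => [r| |]//= _.
move=> [h]; congr EFin.
have -> : r = (r + r) / 2 by field.
by rewrite h; field.
Qed.

(** With q = w / psi this is the h of the overview; a free weight q also covers the power potential,
    whose weight is not a quotient by psi. *)
Definition potential (q : R -> R) (z : R) : \bar R :=
  (\int[leb]_t (q t * (1 - cos (t * z)))%:E)%E.

Lemma potential_ge0 (q : R -> R) z : (forall t, 0 <= q t) -> (0 <= potential q z)%E.
Proof.
move=> q0; apply: integral_ge0 => t _.
by rewrite lee_fin mulr_ge0 ?subr_ge0 ?cos_le1.
Qed.

Lemma measurable_potential (q : R -> R) : measurable_fun setT q -> (forall t, 0 <= q t) ->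
  measurable_fun setT (potential q).
Proof.
move=> mq q0.
pose F (z : R * R) := (q z.2 * (1 - cos (z.2 * z.1)))%:E.
apply: (@measurable_fun_fubini_tonelli_F _ _ _ _ _ leb F).
  apply/measurable_EFinP; apply: measurable_funM.
    by apply: measurableT_comp.
  apply: measurable_funB => //.
  under eq_fun do rewrite mulrC.
  exact: measurable_cos2.
by move=> z; rewrite lee_fin mulr_ge0// subr_ge0 cos_le1.
Qed.

(** Tonelli exchanges the integrals and the shift formula evaluates the inner one. Integrability is
    asked of q psi, not of q, which is singular at 0 in every use; finiteness at z allows the two
    terms to be split. *)
Lemma potential_drift (q : R -> R) (z : R) :
  measurable_fun setT q -> (forall t, 0 <= q t) -> (potential q z < +oo)%E ->
  leb.-integrable setT (fun t => (q t * one_minus_cf t)%:E) ->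
  (\int[mu]_y potential q (z + y)%R =
   potential q z + \int[leb]_t (q t * one_minus_cf t * cos (t * z))%:E)%E.
Proof.
move=> mq q0 qoo iq.
pose F (s : R * R) := (q s.2 * (1 - cos (s.2 * (z + s.1))))%:E.
have mF : measurable_fun setT F.
  apply/measurable_EFinP; apply: measurable_funM.
    exact: measurableT_comp.
  apply: measurable_funB => //.
  apply: measurableT_comp.
    by apply: continuous_measurable_fun; exact: continuous_cos.
  by apply: measurable_funM => //; exact: measurable_funD.
rewrite /potential (@fubini_tonelli _ _ _ _ _ mu leb F mF); last first.
  by move=> s; rewrite lee_fin mulr_ge0// subr_ge0 cos_le1.
have inner t : (\int[mu]_y F (y, t) =
    (q t * (1 - cos (t * z)))%:E + (q t * one_minus_cf t * cos (t * z))%:E)%E.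
  rewrite /F /=; under eq_integral do rewrite EFinM.
  rewrite ge0_integralZl//.
  - by rewrite integral_one_minus_cos_shift -EFinM mulrDr EFinD mulrA.
  - apply/measurable_EFinP; apply: measurable_funB => //.
    apply: (measurableT_comp (measurable_cosM t)).
    by apply: measurable_funD.
  - by rewrite lee_fin.
under eq_integral do rewrite inner.
rewrite integralD//.
  apply/integrableP; split.
    apply/measurable_EFinP; apply: measurable_funM => //.
    apply: measurable_funB => //.
    under eq_fun do rewrite mulrC.
    exact: measurable_cosM.
  under eq_integral => t _ do
    rewrite gee0_abs ?lee_fin ?mulr_ge0 ?subr_ge0 ?cos_le1//.
  exact: qoo.
apply: (le_integrable _ _ _ iq) => //.
  apply/measurable_EFinP; apply: measurable_funM.
    by apply: measurable_funM => //; exact: measurable_one_minus_cf.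
  under eq_fun do rewrite mulrC.
  exact: measurable_cosM.
by move=> t _ /=; rewrite lee_fin [leLHS]normrM ler_piMr// cos_max.
Qed.

End spectral_potential.

(** * Power bounds on potentials; the tent and the Fejer kernel *)

Section potential_bounds.
Context (R : realType).
Local Notation leb := (@lebesgue_measure R).

(** Replacing 1 - cos tz by 2 |tz|^th leaves 2 M |z|^th t^(th - k), which is integrable at 0 because
    k - th < 1. *)
Lemma potential_le (q : R -> R) (L M k th : R) :
  measurable_fun setT q -> 0 < L -> 0 <= M -> 0 <= th <= 2 -> k - th < 1 ->
  (forall t, 0 <= q t) -> (forall t, ~~ (0 < t <= L) -> q t = 0) ->
  (forall t, 0 < t <= L -> q t <= M * t `^ (- k)) ->
  exists2 C : R, 0 <= C & forall z, (potential q z <= (C * `|z| `^ th)%:E)%E.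
Proof.
move=> mq L0 M0 th02 kth q0 qsupp qM.
pose I : \bar R := (\int[leb]_(t in `]0%R, L]) (t `^ (- (k - th)))%:E)%E.
have I0 : (0 <= I)%E by apply: integral_ge0 => t _; rewrite lee_fin powR_ge0.
have Ioo : (I < +oo)%E by exact: integral_inv_powR_lty.
exists (2 * M * fine I); first by rewrite !mulr_ge0// fine_ge0.
move=> z.
have -> : (2 * M * fine I * `|z| `^ th)%:E = ((2 * M * `|z| `^ th)%:E * I)%E.
  by rewrite -[in RHS](@fineK _ I) ?ge0_fin_numE// -EFinM; congr EFin; ring.
rewrite /I -ge0_integralZl//; last 3 first.
- by apply/measurable_EFinP; apply: measurable_funTS; exact: measurable_powR.
- by move=> t _; rewrite lee_fin powR_ge0.
- by rewrite lee_fin !mulr_ge0// powR_ge0.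
rewrite [leRHS]integral_mkcond; apply: ge0_le_integral => //.
- by move=> t _; rewrite lee_fin mulr_ge0// one_minus_cos_ge0.
- apply/measurable_EFinP; apply: measurable_funM => //.
  apply: measurable_funB => //.
  by under eq_fun do rewrite mulrC; exact: measurable_cosM.
- apply: (iffLR (measurable_restrictT _ _)) => //; apply: measurable_funeM.
  by apply/measurable_EFinP; apply: measurable_funTS; exact: measurable_powR.
move=> t _; rewrite patchE mem_setE in_itv/=.
case: ifPn => [tL|/qsupp ->]; last by rewrite mul0r.
have t0 : 0 < t by case/andP: tL.
rewrite -EFinM lee_fin.
apply: (@le_trans _ _ (M * t `^ (- k) * (2 * `|t * z| `^ th))).
  apply: ler_pM; rewrite ?one_minus_cos_ge0 ?qM//.
  exact: one_minus_cos_le_powR.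
rewrite normrM (gtr0_norm t0) powRM ?(ltW t0)//.
have -> : t `^ (- (k - th)) = t `^ (- k) * t `^ th.
  by rewrite -powRD ?(gt_eqF t0) ?implybT//; congr (_ `^ _); ring.
by rewrite le_eqVlt; apply/orP; left; apply/eqP; ring.
Qed.

(** Only t between 1/(2|z|) and 1/|z| is kept. There t^(-b) >= |z|^b and 1 - cos tz >= (1/2)^2 / 4 =
    1/16, and the length 1/(2|z|) turns 16 into 32. *)
Lemma potential_ge (q : R -> R) (L m b z : R) :
  measurable_fun setT q -> 0 <= m -> 0 <= b -> (forall t, 0 <= q t) ->
  (forall t, 0 < t <= L -> m * t `^ (- b) <= q t) -> z != 0 -> `|z|^-1 <= L ->
  ((m / 32 * `|z| `^ (b - 1))%:E <= potential q z)%E.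
Proof.
move=> mq m0 b0 q0 qm z0 zL.
have nz0 : 0 < `|z| by rewrite normr_gt0.
have iz0 : 0 < `|z|^-1 by rewrite invr_gt0.
pose D : set R := [set` `[`|z|^-1 / 2, `|z|^-1]].
have mD : measurable D by exact: measurable_itv.
have -> : (m / 32 * `|z| `^ (b - 1))%:E =
    (\int[leb]_(t in D) (cst (m / 16 * `|z| `^ b)%:E) t)%E.
  rewrite integral_cst//= lebesgue_measure_itv/= lte_fin.
  rewrite ltr_pdivrMr// ltr_pMr// ltr1n -EFinB -EFinM; congr EFin.
  rewrite powRD; last by rewrite (gt_eqF nz0) implybT.
  by rewrite powR_inv1//; field; rewrite gt_eqF.
rewrite integral_mkcond; apply: ge0_le_integral => //.
- move=> t _; rewrite patchE; case: ifP => // _.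
  by rewrite lee_fin mulr_ge0 ?powR_ge0// divr_ge0.
- exact: (iffLR (measurable_restrictT _ _)).
- apply/measurable_EFinP; apply: measurable_funM => //.
  apply: measurable_funB => //.
  by under eq_fun do rewrite mulrC; exact: measurable_cosM.
move=> t _; rewrite patchE /D mem_setE in_itv/=.
case: ifPn => [/andP[tz zt]|_]; last first.
  by rewrite lee_fin mulr_ge0// one_minus_cos_ge0.
have t0 : 0 < t by rewrite (lt_le_trans _ tz)// divr_gt0.
rewrite /= lee_fin.
have tz1 : t * `|z| <= 1 by rewrite -(mulVf (lt0r_neq0 nz0)) ler_pM2r.
have tz2 : 2^-1 <= t * `|z|.
  by rewrite -ler_pdivrMr// mulrC.
apply: (@le_trans _ _ (m * t `^ (- b) * (4^-1 ^+ 2))).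
  rewrite (_ : m / 16 * _ = m * `|z| `^ b * 4^-1 ^+ 2); last by field.
  rewrite ler_wpM2r ?sqr_ge0// ler_wpM2l//.
  have -> : t `^ (- b) = t^-1 `^ b.
    by rewrite -[t^-1]powR_inv1 ?(ltW t0)// -powRrM mulN1r.
  rewrite ge0_ler_powR ?nnegrE ?(ltW nz0) ?invr_ge0 ?(ltW t0)//.
  by rewrite -div1r ler_pdivlMr// mulrC.
apply: ler_pM; rewrite ?mulr_ge0 ?powR_ge0 ?sqr_ge0//.
  by apply: qm; rewrite t0 (le_trans zt).
apply: le_trans (one_minus_cos_ge_sqr _).
  rewrite -(real_normK (num_real (t * z))) normrM (gtr0_norm t0).
  have : 2^-1 ^+ 2 <= (t * `|z|) ^+ 2 by rewrite ler_sqr ?nnegrE ?mulr_ge0 ?(ltW t0).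
  lra.
by rewrite normrM (gtr0_norm t0).
Qed.

(** The support avoids t <= 0, where psi has no positive lower bound; dividing by psi and
    multiplying back is then exact at every t. *)
Definition tent (l t : R) : R := \1_`]0, l] t * (1 - t / l).

(** The cosine transform of the tent for z != 0. At z = 0 division by zero makes the value 0 instead
    of the limit l/2, hence the conditions z != 0 below. *)
Definition fejer (l z : R) : R := (1 - cos (l * z)) / (l * z ^+ 2).

Lemma tentE l t : tent l t = if 0 < t <= l then 1 - t / l else 0.
Proof.
by rewrite /tent indicE mem_setE in_itv/=; case: ifP; rewrite ?mul1r ?mul0r.
Qed.

Lemma tent_ge0 l t : 0 <= tent l t.
Proof.
rewrite tentE; case: ifP => // /andP[t0 tl].
by rewrite subr_ge0 ler_pdivrMr ?mul1r// (lt_le_trans t0).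
Qed.

Lemma tent_le1 l t : tent l t <= 1.
Proof.
rewrite tentE; case: ifP => // /andP[t0 tl].
by rewrite gerBl divr_ge0// ltW// (lt_le_trans t0).
Qed.

Lemma tent_le l L t : l <= L -> tent l t <= tent L t.
Proof.
move=> lL; rewrite [tent l t]tentE; case: ifP => [/andP[t0 tl]|_]; last exact: tent_ge0.
have l0 : 0 < l by rewrite (lt_le_trans t0).
rewrite tentE t0 (le_trans tl lL) lerD2l lerN2 ler_pM2l// lef_pV2 ?posrE//.
exact: lt_le_trans lL.
Qed.

Lemma measurable_tent l : measurable_fun setT (tent l).
Proof.
apply: measurable_funM; first exact: measurable_indic.
by apply: measurable_funB => //; exact: measurable_funM.
Qed.

Lemma integrable_tent l : leb.-integrable setT (EFin \o tent l).
Proof.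
have mt := measurable_tent l.
apply: (@le_integrable _ _ _ leb setT _ _ (fun t => (\1_`]0%R, l] t)%:E)) => //.
- exact/measurable_EFinP.
- move=> t _; rewrite /= lee_fin ger0_norm ?tent_ge0//.
  have := tent_le1 l t; rewrite tentE indicE mem_setE in_itv/=.
  by case: ifP => //= _; rewrite ?normr1 ?normr0.
- exact: integrable_indic_itv.
Qed.

Lemma integrable_tent_cos l z :
  leb.-integrable setT (fun t => (tent l t * cos (t * z))%:E).
Proof.
apply: (le_integrable _ _ _ (integrable_tent l)) => //.
  apply/measurable_EFinP; apply: measurable_funM; first exact: measurable_tent.
  by under eq_fun do rewrite mulrC; exact: measurable_cosM.
by move=> t _; rewrite /= lee_fin normrM ler_piMr// cos_max.
Qed.

Lemma integral_tent_cos l z : 0 < l -> z != 0 ->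
  (\int[leb]_t (tent l t * cos (t * z))%:E = (fejer l z)%:E)%E.
Proof.
move=> l0 z0; rewrite /fejer -integral_fejer//.
pose g t := ((1 - t / l) * cos (t * z))%:E.
have mg : measurable_fun setT g.
  apply/measurable_EFinP; apply: measurable_funM.
    by apply: measurable_funB => //; exact: measurable_funM.
  by under eq_fun do rewrite mulrC; exact: measurable_cosM.
rewrite -integral_itv_obnd_cbnd; last exact: measurable_funTS.
rewrite [RHS]integral_mkcond; apply: eq_integral => t _.
rewrite patchE /tent indicE; case: ifP => _; first by rewrite mul1r.
by rewrite !mul0r.
Qed.

Lemma fejer_ge0 l z : 0 <= l -> 0 <= fejer l z.
Proof. by move=> l0; rewrite divr_ge0 ?one_minus_cos_ge0// mulr_ge0 ?sqr_ge0. Qed.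

Lemma fejer_le l z : 0 < l -> fejer l z <= 2 / l * (z ^+ 2)^-1.
Proof.
move=> l0; rewrite /fejer invfM mulrA ler_wpM2r ?invr_ge0 ?sqr_ge0//.
by rewrite ler_wpM2r ?invr_ge0 ?(ltW l0)// one_minus_cos_le2.
Qed.

(** This makes the kernel count visits: with l = 1/r it is at least 1/(4r) at each nonzero point of
    [-r, r]. *)
Lemma fejer_ge l z : 0 < l -> z != 0 -> l * `|z| <= 1 -> l / 4 <= fejer l z.
Proof.
move=> l0 z0 lz; rewrite /fejer.
have z2 : 0 < z ^+ 2 by rewrite lt_def sqr_ge0 sqrf_eq0 z0.
have lz2 : 0 < l * z ^+ 2 by exact: mulr_gt0.
rewrite ler_pdivlMr//.
have -> : l / 4 * (l * z ^+ 2) = (l * z) ^+ 2 / 4 by field.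
by apply: one_minus_cos_ge_sqr; rewrite normrM (gtr0_norm l0).
Qed.

Lemma measurable_fejer l : 0 <= l -> measurable_fun setT (fun z => (fejer l z)%:E).
Proof.
move=> l0; apply/measurable_EFinP; apply: measurable_funM.
  by apply: measurable_funB => //; exact: measurable_cosM.
rewrite (_ : (fun z => _) = (fun z => (l * z ^+ 2) `^ (-1))).
  apply: (measurableT_comp (measurable_powR _)).
  by apply: measurable_funM.
by apply/funext => z; rewrite powR_inv1// mulr_ge0 ?sqr_ge0.
Qed.

End potential_bounds.

(** * Step distributions with regularly varying tails *)

Section reflection.
Context (R : realType).
Local Notation leb := (@lebesgue_measure R).

Lemma even_density_symmetric (mu : set R -> \bar R) (f : R -> R) :
  measurable_fun setT f -> (forall y, 0 <= f y) -> (forall y, f (- y) = f y) ->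
  (forall B : set R, measurable B -> mu B = (\int[leb]_(y in B) (f y)%:E)%E) ->
  forall B : set R, measurable B -> mu (-%R @^-1` B) = mu B.
Proof.
move=> mf f0 fN muE B mB.
have mN : measurable_fun setT (-%R : R -> R) by exact: oppr_measurable.
have mNB : measurable (-%R @^-1` B) by rewrite -[X in measurable X]setTI; exact: mN.
rewrite !muE//.
transitivity (\int[pushforward leb (-%R : _ -> measurableTypeR R)]_(y in B) (f y)%:E)%E.
  rewrite ge0_integral_pushforward//; last first.
    by move=> y _; rewrite lee_fin.
    by apply/measurable_EFinP; exact: measurable_funTS.
  by apply: eq_integral => y _; rewrite /= fN.
by apply: eq_measure_integral => A mA _; exact: lebesgue_measureN.
Qed.

End reflection.

Section step_law.
Context (R : realType) (mu : probability R R) (v : R -> R) (alpha c : R).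
Hypothesis alpha0 : 0 < alpha.
Hypothesis c0 : 0 < c.
Hypothesis hv : class_D alpha c v.
Hypothesis muE : forall B, measurable B ->
  mu B = (\int[lebesgue_measure]_(y in B) (2^-1 * v `|y|)%:E)%E.
Local Notation leb := (@lebesgue_measure R).
Let f (y : R) := 2^-1 * v `|y|.

Let mf : measurable_fun setT f.
Proof.
case: hv => -[mv _ _] _; apply: measurable_funM => //.
exact: (measurableT_comp mv).
Qed.

Let f0 y : 0 <= f y.
Proof. by case: hv => -[_ v0 _] _; rewrite mulr_ge0. Qed.

Lemma step_law_symmetric (B : set R) : measurable B -> mu (-%R @^-1` B) = mu B.
Proof.
by apply: (@even_density_symmetric _ _ f) => // y; rewrite /f normrN.
Qed.

Lemma step_law_tail_ge : exists2 r0 : R, 1 <= r0 & exists2 k : R, 0 < k &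
  forall (r : R) (B : set R), r0 <= r -> measurable B -> B `<=` `[r, r *+ 2] ->
  ((k * r `^ (- 1 - alpha))%:E * leb B <= mu B)%E.
Proof.
case: hv => _ [cf [_ _ cfc vE _]].
have /cfc : nbhs c [set y | c / 2 < y].
  apply: open_nbhs_nbhs; split; first exact: open_gt.
  by rewrite /= ltr_pdivrMr// ltr_pMr// ltr1n.
move=> [M [_ hM]].
exists (Num.max 1 (M + 1)); first by rewrite le_max lexx.
(* One factor 1/2 is that of the density, the other comes from c(y) > c/2, and the power of 2 from y
   <= 2r. *)
exists (c / 4 * 2 `^ (- 1 - alpha)).
  by rewrite mulr_gt0 ?divr_gt0// powR_gt0.
move=> r B; rewrite ge_max => /andP[r1 rM] mB Br.
have r0 : 0 < r by apply: lt_le_trans r1.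
rewrite muE// -integral_cst//.
apply: ge0_le_integral => //.
- by move=> y _; rewrite lee_fin !mulr_ge0 ?powR_ge0// ltW.
- by apply/measurable_EFinP; exact: measurable_funTS mf.
move=> y /Br/=; rewrite in_itv/= => /andP[ry y2r].
have y0 : 0 < y by apply: lt_le_trans ry.
rewrite lee_fin ger0_norm ?(ltW y0)// vE//.
have cy : c / 2 < cf y.
  by apply: hM; rewrite (lt_le_trans _ ry)// (lt_le_trans _ rM)// ltrDl.
have : 2 `^ (- 1 - alpha) * r `^ (- 1 - alpha) <= y `^ (- 1 - alpha).
  rewrite -powRM ?(ltW r0)// -!opprD.
  rewrite !powRN lef_pV2 ?posrE ?powR_gt0 ?mulr_gt0//.
  rewrite ge0_ler_powR ?nnegrE ?addr_ge0 ?(ltW alpha0) ?(ltW y0)//.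
    by rewrite mulr_ge0// ltW.
  by rewrite mulr_natl.
have yp := powR_ge0 y (- 1 - alpha) => ab.
apply: (@le_trans _ _ (c / 4 * y `^ (- 1 - alpha))).
  by rewrite -mulrA ler_pM2l// divr_gt0.
by rewrite mulrA ler_wpM2r//; lra.
Qed.

Lemma step_law_shell_le : exists2 K : R, 0 <= K & forall j : nat,
  (mu [set y | 2 ^+ j < `|y| <= 2 ^+ j.+1]%R <= (K * (2 ^+ j) `^ (- alpha))%:E)%E.
Proof.
case: hv => _ [cf [cf0 [C hC] _ vE _]].
have C0 : 0 <= C.
  apply: le_trans (hC (cf 1) _); first by rewrite ltW// cf0.
  by exists 1 => //=; rewrite in_itv/= ler01.
(* The factor 1/2 of the density times C times 4, since the shell lies in an interval of length 4 *
   2^j. *)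
exists (2 * C); first by rewrite mulr_ge0.
move=> j; set B := [set y | _].
have j0 : 0 < 2 ^+ j :> R by rewrite exprn_gt0.
have mB : measurable B.
  rewrite (_ : B = Num.norm @^-1` `]2 ^+ j, 2 ^+ j.+1]); last first.
    by apply/seteqP; split => y /=; rewrite in_itv.
  by rewrite -[X in measurable X]setTI; exact: normr_measurable.
rewrite muE//.
pose m := 2^-1 * (C * (2 ^+ j) `^ (- 1 - alpha)).
have m0 : 0 <= m by rewrite !mulr_ge0// powR_ge0.
apply: (@le_trans _ _ (\int[leb]_(y in B) (cst m%:E) y)%E).
  apply: ge0_le_integral => //.
  - by move=> y _; rewrite lee_fin; exact: f0.
  - by apply/measurable_EFinP; exact: measurable_funTS mf.
  move=> y /andP[jy _].
  have y0 : 0 < `|y| by apply: lt_trans jy.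
  rewrite lee_fin /m ler_pM2l ?invr_gt0// vE//.
  apply: ler_pM; rewrite ?powR_ge0//.
  - by rewrite ltW// cf0.
  - by apply: hC; exists `|y| => //=; rewrite in_itv/= andbT.
  rewrite -!opprD.
  rewrite !powRN lef_pV2 ?posrE ?powR_gt0//.
  by rewrite ge0_ler_powR ?nnegrE ?addr_ge0 ?(ltW alpha0) ?(ltW j0) ?(ltW jy).
rewrite integral_cst//.
have : (leb B <= (2 ^+ j.+2)%:E)%E.
  apply: (@le_trans _ _ (leb `[- 2 ^+ j.+1, 2 ^+ j.+1])).
    apply: le_measure; rewrite ?inE//.
    by move=> y /andP[_]; rewrite ler_norml/= in_itv.
  rewrite lebesgue_measure_itv/= lte_fin gtrN ?exprn_gt0// -EFinB opprK.
  by rewrite lee_fin !exprS; lra.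
move=> lB; apply: (@le_trans _ _ (m%:E * (2 ^+ j.+2)%:E)%E).
  by apply: lee_pmul.
rewrite -EFinM lee_fin /m.
have -> : (2 ^+ j) `^ (- 1 - alpha) = (2 ^+ j)^-1 * (2 ^+ j) `^ (- alpha) :> R.
  rewrite powRD; last by rewrite (gt_eqF j0) implybT.
  by rewrite powR_inv1// ltW.
rewrite !exprS le_eqVlt; apply/orP; left; apply/eqP; field.
by rewrite gt_eqF.
Qed.

(** E|X|^b is finite for b < alpha by the shell bound, and 1 - cos(ty) <= 2 |ty|^b is integrated.
    The added 1 in the witness makes C positive. *)
Lemma one_minus_cf_le (b : R) : 0 <= b < alpha -> b <= 2 ->
  exists2 C : R, 0 < C & forall t, one_minus_cf mu t <= C * `|t| `^ b.
Proof.
move=> /andP[b0 ba] b2.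
have [K K0 shell] := step_law_shell_le.
have mom : (\int[mu]_y (`|y| `^ b)%:E < +oo)%E.
  apply: (@dyadic_moment _ _ _ mu setT (fun y => `|y|) K alpha b) => //.
  - by rewrite (le_lt_trans (probability_le1 _ _)) ?ltry.
  - by move=> j; rewrite setTI; exact: shell.
have mom0 : (0 <= \int[mu]_y (`|y| `^ b)%:E)%E.
  by apply: integral_ge0 => y _; rewrite lee_fin powR_ge0.
have mpow : measurable_fun setT (fun y : R => (`|y| `^ b)%:E).
  apply/measurable_EFinP; apply: (measurableT_comp (measurable_powR b)).
  exact: normr_measurable.
exists (2 * fine (\int[mu]_y (`|y| `^ b)%:E)%E + 1).
  by rewrite ltr_wpDl// mulr_ge0// fine_ge0.
move=> t; rewrite -lee_fin -one_minus_cfE.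
apply: (@le_trans _ _ (\int[mu]_y ((2 * `|t| `^ b)%:E * (`|y| `^ b)%:E))%E).
  apply: ge0_le_integral => //.
  - apply/measurable_EFinP; apply: measurable_funB => //; exact: measurable_cosM.
  - by apply: measurable_funeM.
  move=> y _; rewrite -EFinM lee_fin -mulrA -powRM// -normrM.
  by apply: one_minus_cos_le_powR; rewrite b0.
rewrite ge0_integralZl//.
rewrite -[X in (_ * X <= _)%E]fineK ?ge0_fin_numE// -EFinM lee_fin.
set I := fine _; set X := _ `^ _.
by rewrite -subr_ge0 (_ : _ - _ = X) ?powR_ge0//; ring.
Qed.

(* For [t * r >= 8] the mean of [1 - cos (y * t)] over [r, 2r] is at least 3/4,
   so that [1 - cos (y * t) >= 1/2] on a subset of measure at least [r / 8]. *)
Lemma one_minus_cf_ge_alpha : exists2 k : R, 0 < k &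
  forall t, 0 < t -> k * Num.min t 1 `^ alpha <= one_minus_cf mu t.
Proof.
have [r0 r01 [k k0 hk]] := step_law_tail_ge.
exists (k / 16 * (r0 + 8) `^ (- alpha)).
  by rewrite mulr_gt0 ?divr_gt0// powR_gt0//; lra.
move=> t t0; set s := Num.min t 1.
have s0 : 0 < s by rewrite lt_min t0/=.
have s1 : s <= 1 by rewrite ge_min lexx orbT.
have st : s <= t by rewrite ge_min lexx.
(* Large enough for the tail bound, r >= r0, and for t r >= 8, because s <= 1 and s <= t. *)
pose r := (r0 + 8) / s.
have sr : s * r = r0 + 8 by rewrite /r mulrC divfK// gt_eqF.
have rr0 : r0 <= r by nra.
have r_gt0 : 0 < r by lra.
have tr : 8 <= t * r by nra.
pose h (y : R) := 1 - cos (y * t).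
have mh : measurable_fun setT h.
  apply: measurable_funB => //.
  under eq_fun do rewrite mulrC; exact: measurable_cosM.
pose D : set R := [set` `[r, r *+ 2]].
have mD : measurable D by exact: measurable_itv.
pose B := D `&` [set y | 2^-1 <= h y].
have mB : measurable B.
  rewrite (_ : B = D `&` h @^-1` `[2^-1, +oo[).
    by apply: (measurable_funTS mh) => //; exact: measurable_itv.
  by apply/seteqP; split => y [Dy] /=; rewrite in_itv/= andbT.
have lD : leb D = r%:E.
  by rewrite lebesgue_measure_itv/= lte_fin mulr2n ltrDl r_gt0 -EFinB addrK.
have lB : ((r / 8)%:E <= leb B)%E.
  have hD : ((3 / 4 * r)%:E <= \int[leb]_(y in D) (h y)%:E)%E.
    rewrite integral_one_minus_cos//; last by rewrite mulr2n ltrDl.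
    rewrite lee_fin.
    have : (sin (r *+ 2 * t) - sin (r * t)) / t <= r / 4.
      rewrite ler_pdivrMr//.
      have := sin_le1 (r *+ 2 * t); have := sin_geN1 (r * t); nra.
    by rewrite mulr2n; lra.
  (* As h <= 2 on B and h < 1/2 on the rest of D, 3r/4 <= 2 |B| + r/2, which gives |B| >= r/8. *)
  have hB : (\int[leb]_(y in D) (h y)%:E <=
      \int[leb]_(y in D) (2%:E * (\1_B y)%:E + (2^-1)%:E))%E.
    apply: ge0_le_integral => //.
    - by move=> y _; rewrite lee_fin; exact: one_minus_cos_ge0.
    - by apply/measurable_EFinP; exact: measurable_funTS.
    - apply: emeasurable_funD => //; apply: measurable_funeM.
      by apply/measurable_EFinP.
    move=> y Dy; rewrite -EFinM -EFinD lee_fin indicE.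
    case: (boolP (y \in B)) => yB; rewrite /= ?mulr1 ?mulr0 ?add0r.
      by have := one_minus_cos_le2 (y * t); rewrite /h; lra.
    rewrite leNgt; apply: contra yB => hy.
    by rewrite inE; split => //=; exact: ltW.
  have : ((3 / 4 * r)%:E <= 2%:E * leb B + (2^-1 * r)%:E)%E.
    apply: (le_trans hD); apply: (le_trans hB).
    rewrite ge0_integralD//; last by apply: measurable_funeM; exact/measurable_EFinP.
    rewrite integral_cst//= lD -EFinM ge0_integralZl//; last exact/measurable_EFinP.
    rewrite integral_indic//= (_ : B `&` D = B)//.
    by apply: setIidl => y [].
  have lBfin : (leb B \is a fin_num)%E.
    rewrite ge0_fin_numE// (@le_lt_trans _ _ (leb D))//.
      by apply: le_measure; rewrite ?inE// => y [].
    by rewrite lD ltry.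
  rewrite -(fineK lBfin) -EFinM -EFinD !lee_fin; lra.
have hmu : ((k / 16 * r `^ (- alpha))%:E <= \int[mu]_y (1 - cos (t * y))%:E)%E.
  apply: (@le_trans _ _ ((2^-1)%:E * mu B)%E).
    apply: (@le_trans _ _ ((2^-1)%:E * ((k * r `^ (- 1 - alpha))%:E * leb B))%E); last first.
      apply: lee_pmul => //; last by apply: hk => // y [].
      by rewrite mule_ge0// lee_fin mulr_ge0 ?powR_ge0// ltW.
    apply: (@le_trans _ _ ((2^-1)%:E * ((k * r `^ (- 1 - alpha))%:E * (r / 8)%:E))%E); last first.
      have ? : (0 <= (k * r `^ (- 1 - alpha))%:E)%E.
        by rewrite lee_fin mulr_ge0 ?powR_ge0// ltW.
      have ? : (0 <= (r / 8)%:E)%E by rewrite lee_fin; lra.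
      by apply: lee_pmul => //; [exact: mule_ge0|apply: lee_pmul].
    rewrite -!EFinM lee_fin powRD; last by rewrite (gt_eqF r_gt0) implybT.
    rewrite powR_inv1 ?(ltW r_gt0)// le_eqVlt; apply/orP; left; apply/eqP.
    by field; rewrite gt_eqF.
  rewrite -(setIT B) -integral_indic// -ge0_integralZl//; last exact/measurable_EFinP.
  apply: ge0_le_integral => //.
  - by apply: measurable_funeM; exact/measurable_EFinP.
  - apply/measurable_EFinP; apply: measurable_funB => //; exact: measurable_cosM.
  move=> y _; rewrite -EFinM lee_fin indicE.
  case: (boolP (y \in B)) => yB; rewrite /= ?mulr1 ?mulr0 ?one_minus_cos_ge0//.
  by move: yB; rewrite inE => -[_]; rewrite /= /h mulrC.
rewrite one_minus_cfE lee_fin in hmu; apply: le_trans hmu.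
rewrite le_eqVlt; apply/orP; left; apply/eqP; rewrite -mulrA; congr (_ * _).
rewrite !powRN /r powRM ?invr_ge0 ?(ltW s0)//; last by lra.
by rewrite invfM -[s^-1]powR_inv1 ?(ltW s0)// -powRrM mulN1r powRN invrK.
Qed.

(** For t <= 1/(2 r0) the steps in [r0, 2 r0], which have positive probability, already give order
    t^2. For larger t, min(t, 1) is at least 1/(2 r0), and the bound with exponent alpha is a
    positive constant. *)
Lemma one_minus_cf_ge_sqr : exists2 k : R, 0 < k &
  forall t, 0 < t -> k * Num.min t 1 `^ 2 <= one_minus_cf mu t.
Proof.
have [r0 r01 [k k0 hk]] := step_law_tail_ge.
have [k1 k10 hk1] := one_minus_cf_ge_alpha.
have r0_gt0 : 0 < r0 by lra.
pose D : set R := [set` `[r0, r0 *+ 2]].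
have mD : measurable D by exact: measurable_itv.
have muD : 0 < fine (mu D).
  apply: fine_gt0; apply/andP; split; last first.
    by rewrite (le_lt_trans (probability_le1 _ _)) ?ltry.
  apply: lt_le_trans (hk r0 D _ _ _) => //.
  rewrite lebesgue_measure_itv/= lte_fin mulr2n ltrDl r0_gt0 -EFinB addrK.
  by rewrite -EFinM lte_fin !mulr_gt0// powR_gt0.
pose k2 := r0 ^+ 2 / 4 * fine (mu D).
pose k3 := k1 * (2 * r0) `^ (- alpha).
have k20 : 0 < k2 by rewrite mulr_gt0// divr_gt0// exprn_gt0.
have k30 : 0 < k3 by rewrite mulr_gt0// powR_gt0// mulr_gt0.
exists (Num.min k2 k3); first by rewrite lt_min k20.
move=> t t0; set s := Num.min t 1.
have s0 : 0 < s by rewrite lt_min t0/=.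
have s1 : s <= 1 by rewrite ge_min lexx orbT.
have st : s <= t by rewrite ge_min lexx.
have [tr|tr] := leP (t * (2 * r0)) 1.
  apply: (@le_trans _ _ (k2 * t ^+ 2)).
    apply: ler_pM; rewrite ?powR_ge0 ?le_min ?(ltW k20) ?(ltW k30) ?ge_min ?lexx//.
    by rewrite powR_mulrn ?(ltW s0)// ler_sqr ?nnegrE ?(ltW s0) ?(ltW t0).
  rewrite -lee_fin -one_minus_cfE.
  have -> : (k2 * t ^+ 2)%:E = (((t * r0) ^+ 2 / 4)%:E * mu D)%E.
    rewrite -[mu D]fineK ?fin_num_measure// -EFinM; congr EFin.
    by rewrite /k2; ring.
  rewrite -(setIT D) -integral_indic// -ge0_integralZl//; last 2 first.
  - exact/measurable_EFinP.
  - by rewrite lee_fin divr_ge0// sqr_ge0.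
  apply: ge0_le_integral => //.
  - by move=> y _; rewrite -EFinM lee_fin mulr_ge0// divr_ge0// sqr_ge0.
  - by apply: measurable_funeM; exact/measurable_EFinP.
  - apply/measurable_EFinP; apply: measurable_funB => //; exact: measurable_cosM.
  move=> y _; rewrite -EFinM lee_fin indicE.
  case: (boolP (y \in D)) => yD; rewrite /= ?mulr1 ?mulr0 ?one_minus_cos_ge0//.
  move: yD; rewrite inE /D/= in_itv/= mulr2n => /andP[ry yr].
  have y0 : 0 < y by lra.
  have ty0 : 0 < t * y by rewrite mulr_gt0.
  apply: le_trans (one_minus_cos_ge_sqr _).
    have tr0 : 0 < t * r0 by rewrite mulr_gt0.
    by rewrite ler_pM2r ?invr_gt0// ler_sqr ?nnegrE ?(ltW ty0) ?(ltW tr0)// ler_pM2l.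
  by rewrite gtr0_norm//; nra.
have {}tr : (2 * r0)^-1 <= s.
  rewrite le_min; apply/andP; split.
    by rewrite -div1r ler_pdivrMr ?mulr_gt0// ltW.
  by rewrite invf_le1 ?mulr_gt0//; lra.
apply: le_trans (hk1 t t0).
apply: (@le_trans _ _ k3).
  rewrite -[leRHS]mulr1; apply: ler_pM => //; rewrite ?powR_ge0//.
  - by rewrite le_min (ltW k20) (ltW k30).
  - by rewrite ge_min lexx orbT.
  rewrite powR_mulrn ?(ltW s0)// expr_le1//; exact: ltW.
rewrite /k3 ler_pM2l// powRN -powR_inv1 ?powR_ge0// -powRrM (mulrC alpha) powRrM.
rewrite powR_inv1; last by rewrite mulr_ge0// ltW.
rewrite ge0_ler_powR ?nnegrE ?(ltW alpha0) ?(ltW s0)//.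
by rewrite invr_ge0 mulr_ge0// ltW.
Qed.

End step_law.

(** * Drift along the killed walk *)

Section tent_potential.
Context (R : realType) (mu : probability R R).
Hypothesis mu_sym : forall B : set R, measurable B -> mu (-%R @^-1` B) = mu B.
Variable k : R.
Hypothesis k0 : 0 < k.
Hypothesis psi_ge : forall t, 0 < t -> k * Num.min t 1 `^ 2 <= one_minus_cf mu t.
Local Notation leb := (@lebesgue_measure R).
Local Notation psi := (one_minus_cf mu).

Lemma one_minus_cf_gt0 t : 0 < t -> 0 < psi t.
Proof.
move=> t0; apply: lt_le_trans (psi_ge t0).
by rewrite mulr_gt0// powR_gt0// lt_min t0/=.
Qed.

Lemma measurable_div_one_minus_cf (w : R -> R) : measurable_fun setT w ->
  measurable_fun setT (fun t => w t / psi t).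
Proof.
move=> mw; apply: measurable_funM => //.
rewrite (_ : (fun t => (psi t)^-1) = (fun t => psi t `^ (-1))).
  apply: (measurableT_comp (measurable_powR _)).
  exact: measurable_one_minus_cf.
by apply/funext => t; rewrite powR_inv1// one_minus_cf_ge0.
Qed.

(** A quadratic lower bound on psi suffices, as 1 - cos tz is quadratic at 0 as well. Asking only w
    <= tent covers tents and differences of tents together. *)
Lemma potential_div_lty (w : R -> R) (L z : R) : 0 < L -> measurable_fun setT w ->
  (forall t, 0 <= w t) -> (forall t, w t <= tent L t) ->
  (potential (fun t => w t / psi t)%R z < +oo)%E.
Proof.
move=> L0 mw w0 wt.
have w1 t : w t <= 1 by exact: le_trans (wt t) (tent_le1 L t).
(* L may exceed 1, beyond which the lower bound on psi is constant; t <= K min(t, 1) on ]0, L]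
   absorbs this. *)
pose K := Num.max L 1.
have K0 : 0 < K by rewrite lt_max L0.
have [||||||||C C0 hC] := @potential_le R (fun t => w t / psi t) L (K ^+ 2 / k) 2 2.
- exact: measurable_div_one_minus_cf.
- exact: L0.
- by rewrite divr_ge0 ?sqr_ge0// ltW.
- by rewrite lexx ler0n.
- by rewrite subrr ltr01.
- by move=> t; rewrite divr_ge0// one_minus_cf_ge0.
- move=> t tL; rewrite (_ : w t = 0) ?mul0r//.
  apply/eqP; rewrite eq_le w0 andbT; apply: le_trans (wt t) _.
  by rewrite tentE (negbTE tL).
- move=> t /andP[t0 tL].
  have m0 : 0 < Num.min t 1 by rewrite lt_min t0/=.
  apply: (@le_trans _ _ (k * Num.min t 1 `^ 2)^-1).
    rewrite -[leRHS]mul1r; apply: ler_pM; rewrite ?invr_ge0 ?one_minus_cf_ge0//.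
    by rewrite lef_pV2 ?posrE ?psi_ge ?one_minus_cf_gt0// mulr_gt0// powR_gt0.
  rewrite invfM mulrAC powRN !powR_mulrn ?(ltW t0) ?(ltW m0)// mulrC.
  rewrite ler_pM2r ?invr_gt0//.
  have : t <= K * Num.min t 1.
    have [t1|t1] := leP t 1; first by rewrite ler_peMl ?(ltW t0)// le_max lexx orbT.
    by rewrite mulr1 le_max tL.
  move=> tK; rewrite ler_pdivlMr ?exprn_gt0// mulrC ler_pdivrMr ?exprn_gt0//.
  by rewrite -exprMn ler_sqr ?nnegrE ?(ltW t0)// mulr_ge0// ltW.
by apply: le_lt_trans (hC z) _; rewrite ltry.
Qed.

Lemma div_one_minus_cfK (w : R -> R) (L : R) :
  (forall t, 0 <= w t) -> (forall t, w t <= tent L t) ->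
  (fun t => w t / psi t * psi t) = w.
Proof.
move=> w0 wt; apply/funext => t.
have [t0|t0] := ltP 0 t; first by rewrite divfK// gt_eqF// one_minus_cf_gt0.
have -> : w t = 0; last by rewrite !mul0r.
apply/eqP; rewrite eq_le w0 andbT; apply: le_trans (wt t) _.
by rewrite tentE ltNge t0.
Qed.

Lemma tent_potential_drift (L z : R) : 0 < L -> z != 0 ->
  (\int[mu]_y potential (fun t => tent L t / psi t)%R (z + y)%R =
   potential (fun t => tent L t / psi t)%R z + (fejer L z)%:E)%E.
Proof.
move=> L0 z0.
have t0 t : 0 <= tent L t by exact: tent_ge0.
have qE := div_one_minus_cfK t0 (fun t => lexx (tent L t)).
rewrite potential_drift//.
- congr (_ + _)%E; rewrite -integral_tent_cos//; apply: eq_integral => t _.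
  by rewrite (congr1 (@^~ t) qE).
- by apply: measurable_div_one_minus_cf; exact: measurable_tent.
- by move=> t; rewrite divr_ge0// one_minus_cf_ge0.
- by apply: (potential_div_lty _ L0) => //; exact: measurable_tent.
- by rewrite (funext (fun t => congr1 EFin (congr1 (@^~ t) qE))); exact: integrable_tent.
Qed.

(** The negative part of the drift stands on the left, so that both sides are sums of nonnegative
    terms, ready to be summed along the walk. *)
Lemma tentB_potential_drift (l L z : R) : 0 < l -> l <= L -> z != 0 ->
  (\int[mu]_y potential (fun t => (tent L t - tent l t) / psi t)%R (z + y)%R
     + (fejer l z)%:E =
   potential (fun t => (tent L t - tent l t) / psi t)%R z + (fejer L z)%:E)%E.
Proof.
move=> l0 lL z0; have L0 : 0 < L by exact: lt_le_trans lL.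
pose w t := tent L t - tent l t.
have w0 t : 0 <= w t by rewrite subr_ge0 tent_le.
have wt t : w t <= tent L t by rewrite gerBl tent_ge0.
have mw : measurable_fun setT w.
  by apply: measurable_funB; exact: measurable_tent.
have qE := div_one_minus_cfK w0 wt.
rewrite potential_drift//.
- rewrite -addeA; congr (_ + _)%E.
  have -> : (\int[leb]_t (w t / psi t * psi t * cos (t * z))%:E)%E =
      ((fejer L z)%:E - (fejer l z)%:E)%E.
    rewrite -!integral_tent_cos// -integralB_EFin//; try exact: integrable_tent_cos.
    apply: eq_integral => t _.
    by rewrite (congr1 (@^~ t) qE) /w mulrBl EFinB.
  by rewrite -EFinB -EFinD subrK.
- exact: measurable_div_one_minus_cf.
- by move=> t; apply: divr_ge0; [exact: w0|exact: one_minus_cf_ge0].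
- exact: (potential_div_lty _ L0).
- rewrite (funext (fun t => congr1 EFin (congr1 (@^~ t) qE))).
  under eq_fun do rewrite /w EFinB.
  by apply: integrableB => //; exact: integrable_tent.
Qed.

(** On ]0, L/2] the tent is at least 1/2, so the weight is at least t^(-b) / (2C). *)
Lemma tent_potential_ge (L C b z : R) : 0 < L -> 0 < C -> 0 <= b ->
  (forall t, psi t <= C * `|t| `^ b) -> z != 0 -> `|z|^-1 <= L / 2 ->
  (((2 * C)^-1 / 32 * `|z| `^ (b - 1))%:E <=
   potential (fun t => tent L t / psi t)%R z)%E.
Proof.
move=> L0 C0 b0 psi_le; apply: potential_ge => //.
- by apply: measurable_div_one_minus_cf; exact: measurable_tent.
- by rewrite invr_ge0 mulr_ge0// ltW.
- by move=> t; rewrite divr_ge0 ?tent_ge0// one_minus_cf_ge0.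
move=> t /andP[t0 tL].
have tt : 2^-1 <= tent L t.
  have t1 : t <= L.
    by apply: (le_trans tL); apply: ler_piMr; [exact: ltW|rewrite invf_le1// ler1n].
  rewrite tentE t0 t1/= lerBrDl -lerBrDr (_ : 1 - 2^-1 = 2^-1); last by lra.
  by rewrite (ler_pdivrMr _ _ L0) mulrC.
have pt := psi_le t; rewrite gtr0_norm// in pt.
have p0 := one_minus_cf_gt0 t0.
have tb := powR_gt0 b t0.
rewrite invfM -mulrA; apply: ler_pM => //.
  by rewrite mulr_ge0 ?powR_ge0// invr_ge0 ltW.
by rewrite powRN -invfM lef_pV2// posrE mulr_gt0.
Qed.

End tent_potential.

Lemma measurable_integral_shift (R : realType) (mu : probability R R)
    (g : R -> \bar R) : (forall y, 0 <= g y)%E -> measurable_fun setT g ->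
  measurable_fun setT (fun z : R => \int[mu]_y g (z + y)%R)%E.
Proof.
move=> g0 mg; pose F (s : R * R) := g (s.1 + s.2).
apply: (@measurable_fun_fubini_tonelli_F _ _ _ _ _ mu F) => [|s]; last exact: g0.
by apply: measurableT_comp => //; exact: measurable_funD.
Qed.

(** * Summing a drift inequality along the killed walk *)

Section killed_functionals.
Context (R : realType) (d : measure_display) (T : measurableType d).
Variables (P : probability T R) (X : nat -> T -> R) (mu : probability R R).
Hypothesis mX : forall n, measurable_fun setT (X n).
Hypothesis indX : mutually_independent P X.
Hypothesis lawX : forall n B, measurable B -> P (X n @^-1` B) = mu B.
Variables (x : R) (D : nat -> set R).
Hypothesis mD : forall n, measurable (D n).
Local Notation S := (walk X x).
Local Notation A := (alive X x D).

Let mA n : measurable (A n).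
Proof. exact: measurable_alive. Qed.

Let mS n : measurable_fun setT (S n).
Proof. exact: measurable_walk. Qed.

Lemma measurable_walk_comp n (g : R -> \bar R) E : measurable_fun setT g ->
  measurable_fun E (fun w => g (S n w)).
Proof. by move=> mg; apply: measurable_funTS; exact: measurableT_comp. Qed.

(** Here phi is the downward drift to be collected and chi the upward drift to be paid. The part of
    g lost on leaving the domain is nonnegative and is dropped. *)
Lemma killed_step (g phi chi : R -> \bar R) n :
  (forall y, 0 <= g y)%E -> (forall y, 0 <= phi y)%E -> (forall y, 0 <= chi y)%E ->
  measurable_fun setT g -> measurable_fun setT phi -> measurable_fun setT chi ->
  (forall z, D n z -> \int[mu]_y g (z + y)%R + phi z <= g z + chi z)%E ->
  (\int[P]_(w in A n.+1) g (S n.+1 w) + \int[P]_(w in A n) phi (S n w) <=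
   \int[P]_(w in A n) g (S n w) + \int[P]_(w in A n) chi (S n w))%E.
Proof.
move=> g0 phi0 chi0 mg mphi mchi h.
have mint := measurable_integral_shift mu g0 mg.
have int0 z : (0 <= \int[mu]_y g (z + y)%R)%E by apply: integral_ge0.
apply: (@le_trans _ _ (\int[P]_(w in A n) g (S n.+1 w) +
    \int[P]_(w in A n) phi (S n w))%E).
  apply: leeD => //; apply: ge0_subset_integral => //.
  - exact: measurable_walk_comp.
  - by rewrite aliveS; apply: subIsetl.
rewrite (integral_alive_step mX indX lawX x mD)// -!ge0_integralD//;
  try exact: measurable_walk_comp; try exact: (@measurable_walk_comp n _ (A n) mint).
apply: ge0_le_integral => //.
- by move=> w _; exact: adde_ge0.
- apply: emeasurable_funD; last exact: measurable_walk_comp.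
  exact: (@measurable_walk_comp n _ (A n) mint).
- by apply: emeasurable_funD; exact: measurable_walk_comp.
- by move=> w /(_ n (leqnn n)); exact: h.
Qed.

Lemma killed_sum (g phi chi : R -> \bar R) n :
  (forall y, 0 <= g y)%E -> (forall y, 0 <= phi y)%E -> (forall y, 0 <= chi y)%E ->
  measurable_fun setT g -> measurable_fun setT phi -> measurable_fun setT chi ->
  (forall k z, D k z -> \int[mu]_y g (z + y)%R + phi z <= g z + chi z)%E ->
  (\int[P]_(w in A n) g (S n w) + \sum_(k < n) \int[P]_(w in A k) phi (S k w) <=
   g x + \sum_(k < n) \int[P]_(w in A k) chi (S k w))%E.
Proof.
move=> g0 phi0 chi0 mg mphi mchi h; elim: n => [|n IH].
  rewrite !big_ord0 !adde0.
  under eq_integral do rewrite /walk big_ord0 addr0.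
  rewrite integral_cst// -[leRHS]mule1; apply: lee_pmul => //.
  exact: probability_le1.
rewrite !big_ord_recr/=.
have st := killed_step g0 phi0 chi0 mg mphi mchi (h n).
apply: (@le_trans _ _ (\int[P]_(w in A n) g (S n w) +
    \int[P]_(w in A n) chi (S n w) + \sum_(k < n) \int[P]_(w in A k) phi (S k w))%E).
  by rewrite addeA addeAC; exact: leeD.
by rewrite addeAC [leRHS]addeA; exact: leeD.
Qed.

End killed_functionals.

(** * Upper bound for the survival probability *)

Definition outside (R : realType) (r : R) : set R := [set y : R | r < `|y|].

Lemma measurable_outside (R : realType) (r : R) : measurable (outside r).
Proof.
rewrite (_ : outside r = Num.norm @^-1` `]r, +oo[).
  by rewrite -[X in measurable X]setTI; exact: normr_measurable.
by apply/seteqP; split => y /=; rewrite /outside/= in_itv/= andbT.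
Qed.

Section green_functional.
Context (R : realType) (d : measure_display) (T : measurableType d).
Variables (P : probability T R) (X : nat -> T -> R).
Hypothesis mX : forall n, measurable_fun setT (X n).
Variables (x : R) (E : set R).
Hypothesis mE : measurable E.
Local Notation S := (walk X x).
Local Notation A := (alive X x (fun=> E)).

Let mA n : measurable (A n).
Proof. exact: measurable_alive. Qed.

Let AE n w : A n w -> E (S n w).
Proof. by move=> /(_ n (leqnn n)). Qed.

Let mSg n (g : R -> R) B : measurable_fun setT g ->
  measurable_fun B (fun w => (g (S n w))%:E).
Proof.
move=> mg; apply: (@measurable_walk_comp _ _ _ _ mX x n (EFin \o g)).
exact/measurable_EFinP.
Qed.

(** The Green operator of the killed walk, truncated at time n: truncation keeps it finite for
    bounded g, which the absorption in [V_bound] needs. *)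
Definition green n (g : R -> R) : \bar R :=
  (\sum_(k < n) \int[P]_(w in A k) (g (S k w))%:E)%E.

Lemma green_ge0 n (g : R -> R) : (forall y, E y -> 0 <= g y) -> (0 <= green n g)%E.
Proof.
move=> g0; apply: sume_ge0 => k _; apply: integral_ge0 => w /AE/g0.
by rewrite lee_fin.
Qed.

Lemma green_le n (g1 g2 : R -> R) : measurable_fun setT g1 -> measurable_fun setT g2 ->
  (forall y, E y -> 0 <= g1 y <= g2 y) -> (green n g1 <= green n g2)%E.
Proof.
move=> m1 m2 g12; apply: lee_sum => k _; apply: ge0_le_integral => //.
- by move=> w /AE/g12/andP[]; rewrite lee_fin.
- exact: mSg.
- exact: mSg.
- by move=> w /AE/g12/andP[]; rewrite lee_fin.
Qed.

Lemma greenD n (g1 g2 : R -> R) : measurable_fun setT g1 -> measurable_fun setT g2 ->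
  (forall y, E y -> 0 <= g1 y) -> (forall y, E y -> 0 <= g2 y) ->
  (green n (fun y => g1 y + g2 y)%R = green n g1 + green n g2)%E.
Proof.
move=> m1 m2 g10 g20; rewrite /green -big_split/=; apply: eq_bigr => k _.
under eq_integral do rewrite EFinD.
rewrite ge0_integralD//.
- by move=> w /AE/g10; rewrite lee_fin.
- exact: mSg.
- by move=> w /AE/g20; rewrite lee_fin.
- exact: mSg.
Qed.

Lemma greenZ n (c : R) (g : R -> R) : 0 <= c -> measurable_fun setT g ->
  (forall y, E y -> 0 <= g y) ->
  (green n (fun y => c * g y)%R = c%:E * green n g)%E.
Proof.
move=> c0 mg g0; rewrite /green ge0_sume_distrr; last first.
  by move=> k _; apply: integral_ge0 => w /AE/g0; rewrite lee_fin.
apply: eq_bigr => k _; under eq_integral do rewrite EFinM.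
rewrite ge0_integralZl//.
- exact: mSg.
- by move=> w /AE/g0; rewrite lee_fin.
Qed.

Lemma green_cst_le n (c : R) : 0 <= c -> (green n (fun=> c) <= (c * n%:R)%:E)%E.
Proof.
move=> c0; rewrite mulr_natr -[n in (c *+ n)]card_ord -sumr_const -sumEFin.
apply: lee_sum => k _; rewrite integral_cst//.
by rewrite -[leRHS]mule1; apply: lee_pmul => //; exact: probability_le1.
Qed.

End green_functional.

Section survival_upper_bound.
Context (R : realType) (d : measure_display) (T : measurableType d).
Variables (P : probability T R) (X : nat -> T -> R) (mu : probability R R).
Hypothesis mX : forall n, measurable_fun setT (X n).
Hypothesis indX : mutually_independent P X.
Hypothesis lawX : forall n B, measurable B -> P (X n @^-1` B) = mu B.
Hypothesis mu_sym : forall B : set R, measurable B -> mu (-%R @^-1` B) = mu B.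
Variables (k C b : R).
Hypothesis k0 : 0 < k.
Hypothesis psi_ge : forall t, 0 < t -> k * Num.min t 1 `^ 2 <= one_minus_cf mu t.
Hypothesis C0 : 0 < C.
Hypothesis b1 : 1 < b.
Hypothesis psi_le : forall t, one_minus_cf mu t <= C * `|t| `^ b.
Variables (x a : R).
Hypothesis a0 : 0 < a.
Local Notation psi := (one_minus_cf mu).
Local Notation E := [set y : R | a < `|y|].
Local Notation S := (walk X x).
Local Notation A := (alive X x (fun=> E)).
Local Notation G := (green P X x E).

Let mE : measurable E.
Proof. exact: measurable_outside. Qed.

Let E_neq0 y : E y -> y != 0.
Proof. by move=> ay; rewrite -normr_gt0 (lt_trans a0). Qed.

Let invsq (y : R) : R := (y ^+ 2)^-1.

Let invsq0 y : 0 <= invsq y.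
Proof. by rewrite invr_ge0 sqr_ge0. Qed.

Let minvsq : measurable_fun setT invsq.
Proof.
rewrite (_ : invsq = (fun y => (y ^+ 2) `^ (-1))).
  exact: (measurableT_comp (measurable_powR _)).
by apply/funext => y; rewrite powR_inv1// sqr_ge0.
Qed.

Let invsq_le (r y : R) : 0 < r -> r < `|y| -> invsq y <= (r ^+ 2)^-1.
Proof.
move=> r0 ry.
have r20 : 0 < r ^+ 2 by rewrite exprn_gt0.
have y2 : r ^+ 2 < y ^+ 2.
  by rewrite -[y ^+ 2]real_normK ?num_real// ltr_sqr ?nnegrE ?(ltW r0).
have y20 : 0 < y ^+ 2 by exact: lt_trans y2.
by rewrite /invsq lef_pV2 ?posrE// ltW.
Qed.

Let inball (r y : R) : R := \1_[set y : R | `|y| <= r] y.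

Let inballE r y : inball r y = (`|y| <= r)%R%:R.
Proof.
rewrite /inball indicE; case: (boolP (`|y| <= r)) => yr; first by rewrite mem_set.
by rewrite memNset//; apply/negP.
Qed.

Let inball0 r y : 0 <= inball r y.
Proof. by rewrite inballE. Qed.

Let minball r : measurable_fun setT (inball r).
Proof.
apply: measurable_indic; rewrite (_ : mkset _ = `[- r, r]%classic)//.
by apply/seteqP; split => y /=; rewrite in_itv/= ler_norml.
Qed.

(* With this value of [L], the bound on [V] derived in [V_bound] has [V / 2] on
   its right-hand side, which can be absorbed. *)
Let L := 64 / a.
Let L0 : 0 < L. Proof. by rewrite divr_gt0. Qed.

Let h := potential (fun t => tent L t / psi t).
Let H := fine (h x).

Let q0 (w : R -> R) : (forall t, 0 <= w t) -> forall t, 0 <= w t / psi t.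
Proof. by move=> w0 t; rewrite divr_ge0// one_minus_cf_ge0. Qed.

Let h0 y : (0 <= h y)%E.
Proof. by apply: potential_ge0; apply: q0 => t; exact: tent_ge0. Qed.

Let hE y : h y = (fine (h y))%:E.
Proof.
rewrite fineK// ge0_fin_numE//.
by apply: (potential_div_lty k0 psi_ge _ L0) => // *;
  [exact: measurable_tent|exact: tent_ge0].
Qed.

Let mh : measurable_fun setT h.
Proof.
apply: measurable_potential; last by apply: q0 => t; exact: tent_ge0.
by apply: measurable_div_one_minus_cf; exact: measurable_tent.
Qed.

Let V n : R := fine (G n invsq).

Let VE n : G n invsq = (V n)%:E.
Proof.
rewrite fineK// ge0_fin_numE; last by apply: green_ge0.
apply: (@le_lt_trans _ _ (G n (fun=> (a ^+ 2)^-1))).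
  apply: green_le => // y ay; rewrite invsq0/=; exact: invsq_le.
apply: (@le_lt_trans _ _ ((a ^+ 2)^-1 * n%:R)%:E); last exact: ltry.
by apply: (green_cst_le P mX x mE); rewrite invr_ge0 sqr_ge0.
Qed.

Let V0 n : 0 <= V n.
Proof. by rewrite fine_ge0// green_ge0. Qed.

Let H0 : 0 <= H. Proof. exact: fine_ge0. Qed.

(** The budget in all occupation bounds: the initial potential plus the cost of the upward drift, as
    the kernel at L is at most (2/L) / y^2. *)
Let B n := H + 2 / L * V n.

Let B0 n : 0 <= B n.
Proof. by rewrite addr_ge0// mulr_ge0// divr_ge0// ltW. Qed.

Let mfejer (l : R) : 0 < l -> measurable_fun setT (fejer l).
Proof. by move=> l0; apply/measurable_EFinP; apply: measurable_fejer; exact: ltW. Qed.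

Let green_fejerL n : (G n (fejer L) <= (2 / L * V n)%:E)%E.
Proof.
have L20 : 0 <= 2 / L by rewrite divr_ge0// ltW.
apply: (@le_trans _ _ (G n (fun y => 2 / L * invsq y))).
  apply: green_le => //; first exact: mfejer.
    exact: measurable_funM.
  by move=> y _; rewrite fejer_ge0 ?(ltW L0)// fejer_le.
by rewrite greenZ// VE.
Qed.

(** The potential of the difference of tents has drift [fejer L] minus [fejer l]. Its value at x is
    at most h x whatever l is, so the bound is uniform in l. *)
Let green_fejer n (l : R) : 0 < l -> l <= L -> (G n (fejer l) <= (B n)%:E)%E.
Proof.
move=> l0 lL.
pose g := potential (fun t => (tent L t - tent l t) / psi t).
have w0 t : 0 <= tent L t - tent l t by rewrite subr_ge0 tent_le.
have mw : measurable_fun setT (fun t => tent L t - tent l t).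
  by apply: measurable_funB; exact: measurable_tent.
have := @killed_sum _ _ _ _ _ _ mX indX lawX x (fun=> E) (fun=> mE) g
  (fun y => (fejer l y)%:E) (fun y => (fejer L y)%:E) n.
have g0 y : (0 <= g y)%E by apply: potential_ge0; exact: q0.
move=> /(_ g0) ks; apply: (@le_trans _ _ (g x + G n (fejer L))%E).
  apply: le_trans (ks _ _ _ _ _ _).
  - by rewrite leeDr//; apply: integral_ge0.
  - by move=> y; rewrite lee_fin fejer_ge0// ltW.
  - by move=> y; rewrite lee_fin fejer_ge0// ltW.
  - by apply: measurable_potential; [exact: measurable_div_one_minus_cf|exact: q0].
  - by apply: measurable_fejer; exact: ltW.
  - by apply: measurable_fejer; exact: ltW.
  - by move=> _ z /E_neq0 z0; rewrite (tentB_potential_drift mu_sym k0 psi_ge).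
rewrite /B EFinD; apply: leeD => //.
rewrite /H -hE; apply: ge0_le_integral => //.
- by move=> t _; rewrite lee_fin mulr_ge0 ?one_minus_cos_ge0//; exact: (q0 w0).
- apply/measurable_EFinP; apply: measurable_funM.
    exact: measurable_div_one_minus_cf.
  apply: measurable_funB => //.
  by under eq_fun do rewrite mulrC; exact: measurable_cosM.
- apply/measurable_EFinP; apply: measurable_funM.
    by apply: measurable_div_one_minus_cf; exact: measurable_tent.
  apply: measurable_funB => //.
  by under eq_fun do rewrite mulrC; exact: measurable_cosM.
move=> t _; rewrite lee_fin ler_wpM2r ?one_minus_cos_ge0//.
by rewrite ler_wpM2r ?invr_ge0 ?one_minus_cf_ge0// gerBl tent_ge0.
Qed.

Let integral_potential_le n : (\int[P]_(w in A n) h (S n w) <= (B n)%:E)%E.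
Proof.
have := @killed_sum _ _ _ _ _ _ mX indX lawX x (fun=> E) (fun=> mE) h
  (fun=> 0%E) (fun y => (fejer L y)%:E) n.
move=> ks; apply: (@le_trans _ _ (h x + G n (fejer L))%E).
  apply: le_trans (ks _ _ _ _ _ _ _) => //.
  - by rewrite leeDl//; apply: sume_ge0 => i _; apply: integral_ge0.
  - by move=> y; rewrite lee_fin fejer_ge0// ltW.
  - by apply: measurable_fejer; exact: ltW.
  - by move=> _ z /E_neq0 z0; rewrite adde0 (tent_potential_drift mu_sym k0 psi_ge).
by rewrite /B EFinD /H -hE; apply: leeD.
Qed.

(** The kernel at l = 1/r dominates the indicator of [-r, r] up to the factor 4r; r >= a gives l <=
    L. *)
Let green_near n (r : R) : a <= r -> (G n (inball r) <= (4 * r * B n)%:E)%E.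
Proof.
move=> ar; have r0 : 0 < r by exact: lt_le_trans ar.
have ir0 : 0 < r^-1 by rewrite invr_gt0.
have rL : r^-1 <= L.
  rewrite /L -div1r ler_pdivrMr// mulrAC ler_pdivlMr// mul1r; lra.
rewrite EFinM.
apply: (@le_trans _ _ ((4 * r)%:E * G n (fejer r^-1))%E); last first.
  apply: lee_pmul => //.
  - by rewrite lee_fin; lra.
  - by apply: green_ge0 => y _; rewrite fejer_ge0// ltW.
  - exact: green_fejer.
rewrite -greenZ//; last 3 first.
- by lra.
- exact: mfejer.
- by move=> y _; rewrite fejer_ge0// ltW.
apply: green_le => //; first by apply: measurable_funM => //; exact: mfejer.
move=> y ay; rewrite inball0/= inballE.
have f0 : 0 <= fejer r^-1 y by rewrite fejer_ge0// ltW.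
case: (leP `|y| r) => /= yr; last by apply: mulr_ge0 => //; lra.
have := @fejer_ge _ r^-1 y ir0 (E_neq0 ay); rewrite mulrC ler_pdivrMr// mul1r.
move=> /(_ yr) fr; rewrite -(@ler_pM2l _ (r^-1 / 4)) ?divr_gt0// mulr1.
apply: (le_trans fr); rewrite le_eqVlt; apply/orP; left; apply/eqP.
by field; rewrite gt_eqF.
Qed.

Let far (j : nat) (y : R) : R := invsq y * (1 - inball (2 ^+ j * a) y).

Let far0 j y : 0 <= far j y.
Proof. by rewrite mulr_ge0// subr_ge0 inballE lern1 leq_b1. Qed.

Let mfar j : measurable_fun setT (far j).
Proof. by apply: measurable_funM => //; exact: measurable_funB. Qed.

Let pow2a (j : nat) : 0 < 2 ^+ j * a.
Proof. by rewrite mulr_gt0// exprn_gt0. Qed.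

(** On the ring between 2^j a and 2^(j+1) a, 1/y^2 is at most 1/(2^j a)^2, and the number of visits
    at most 4 * 2^(j+1) a * B n; the product decays like 2^-j. *)
Let green_farS n j :
  (G n (far j) <= (8 * B n / a * 2^-1 ^+ j)%:E + G n (far j.+1))%E.
Proof.
have c0 : 0 <= ((2 ^+ j * a) ^+ 2)^-1 by rewrite invr_ge0 sqr_ge0.
apply: (@le_trans _ _ (G n (fun y => ((2 ^+ j * a) ^+ 2)^-1 * inball (2 ^+ j.+1 * a) y
    + far j.+1 y))).
  apply: green_le => //.
    by apply: measurable_funD => //; exact: measurable_funM.
  move=> y ay; rewrite far0/= /far !inballE.
  case: (leP `|y| (2 ^+ j * a)) => yj /=.
    by rewrite subrr mulr0; apply: addr_ge0; apply: mulr_ge0 => //; rewrite subr_ge0 lern1 leq_b1.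
  rewrite subr0 mulr1; have yV := invsq_le (pow2a j) yj.
  case: (leP `|y| (2 ^+ j.+1 * a)) => _ /=; first by rewrite subrr mulr0 mulr1 addr0.
  by rewrite mulr0 add0r subr0 mulr1.
rewrite greenD//; last 2 first.
- exact: measurable_funM.
- by move=> y _; rewrite mulr_ge0.
apply: leeD => //; rewrite greenZ//.
apply: (@le_trans _ _ (((2 ^+ j * a) ^+ 2)^-1%:E * (4 * (2 ^+ j.+1 * a) * B n)%:E)%E).
  apply: lee_pmul => //; first by apply: green_ge0.
  by apply: green_near; rewrite ler_peMl ?(ltW a0)// exprn_ege1// ler1n.
rewrite -EFinM lee_fin le_eqVlt; apply/orP; left; apply/eqP.
rewrite [2 ^+ j.+1]exprS exprVn.
have : 2 ^+ j != 0 :> R by rewrite gt_eqF// exprn_gt0.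
move: (2 ^+ j) => u u0; field.
by rewrite u0 gt_eqF.
Qed.

Let green_far n j : (G n (far j) <= (((2 ^+ j * a) ^+ 2)^-1 * n%:R)%:E)%E.
Proof.
have c0 : 0 <= ((2 ^+ j * a) ^+ 2)^-1 by rewrite invr_ge0 sqr_ge0.
apply: le_trans (green_cst_le P mX x mE n c0).
apply: green_le => // y ay; rewrite far0/= /far inballE.
case: (leP `|y| (2 ^+ j * a)) => yj /=; first by rewrite subrr mulr0.
by rewrite subr0 mulr1 invsq_le.
Qed.

Let V_le_sum n j :
  (G n invsq <= (8 * B n / a * \sum_(i < j) 2^-1 ^+ i)%:E + G n (far j))%E.
Proof.
elim: j => [|j IH].
  rewrite big_ord0 mulr0 add0e; apply: green_le => // y ay.
  have ya : (`|y| <= a) = false by rewrite leNgt ay.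
  by rewrite invsq0/= /far inballE expr0 mul1r ya subr0 mulr1.
apply: (le_trans IH); rewrite big_ord_recr/= (mulrDr (8 * B n / a)) EFinD -addeA leeD//.
Qed.

(** Summing the first n rings costs at most 16 B n / a. Beyond them 1/y^2 is at most 1/(4^n a^2), so
    n time steps contribute at most 1/a^2. *)
Let V_bound n : V n <= 32 * H / a + 2 * (a ^+ 2)^-1.
Proof.
suff : V n <= 16 * B n / a + (a ^+ 2)^-1.
  have -> : 16 * B n / a = 16 * H / a + V n / 2.
    by rewrite /B /L; field; rewrite gt_eqF.
  by lra.
rewrite -lee_fin -VE; apply: (le_trans (V_le_sum n n)).
rewrite EFinD; apply: leeD.
  rewrite lee_fin.
  have : \sum_(i < n) 2^-1 ^+ i <= 2 :> R.
    have -> : \sum_(i < n) 2^-1 ^+ i = series (geometric 1 2^-1) n :> R.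
      by rewrite /series/= big_mkord; apply: eq_bigr => i _; rewrite mul1r.
    rewrite geometric_seriesE ?lt_eqF ?invf_lt1 ?ltr1n//=.
    rewrite (_ : 1 - 2^-1 = 2^-1 :> R); last by lra.
    have : 0 <= 2^-1 ^+ n :> R by rewrite exprn_ge0.
    by rewrite invrK mul1r; lra.
  move=> s2; apply: (@le_trans _ _ (8 * B n / a * 2)); last by lra.
  by rewrite ler_wpM2l// divr_ge0 ?mulr_ge0// ltW.
apply: (le_trans (green_far n n)); rewrite lee_fin exprMn invfM.
rewrite mulrAC ler_piMl ?invr_ge0 ?sqr_ge0//.
rewrite mulrC ler_pdivrMr ?exprn_gt0// mul1r -natrX -natrX ler_nat.
by apply: (leq_trans (ltnW (ltn_expl n (ltnSn 1)))); rewrite -expnM leq_pexp2l// leq_pmulr.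
Qed.

Lemma survival_le : exists2 K : R, 0 <= K & forall n, (0 < n)%N ->
  (P (A n) <= (K * n%:R `^ (b^-1 - 1))%:E)%E.
Proof.
have b0 : 0 < b := lt_trans ltr01 b1.
have bm1 : 0 < b - 1 by rewrite subr_gt0.
pose V1 := 32 * H / a + 2 * (a ^+ 2)^-1.
pose B1 := H + 2 / L * V1.
have BB1 n : B n <= B1 by rewrite lerD2l ler_wpM2l ?V_bound// divr_ge0// ltW.
have B10 : 0 <= B1 by exact: le_trans (B0 0%N) (BB1 0%N).
pose m := (2 * C)^-1 / 32.
have m0 : 0 < m by rewrite divr_gt0 ?invr_gt0 ?mulr_gt0.
have hge z : z != 0 -> `|z|^-1 <= L / 2 -> ((m * `|z| `^ (b - 1))%:E <= h z)%E.
  exact: (tent_potential_ge k0 psi_ge L0 C0 (ltW b0) psi_le).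
(* The bound on visits needs M >= a, the lower bound on h needs |y| >= 2/L. *)
pose M0 := Num.max a (2 / L).
have M00 : 0 < M0 by rewrite lt_max a0.
exists (4 * M0 * B1 + B1 / (m * M0 `^ (b - 1))).
  apply: addr_ge0; first by do 2 apply: mulr_ge0 => //; exact: ltW.
  by apply: divr_ge0 => //; apply: mulr_ge0; [exact: ltW|exact: powR_ge0].
move=> n n0.
have n1 : 1 <= n%:R :> R by rewrite ler1n.
have n0R : 0 < n%:R :> R by rewrite ltr0n.
pose M := M0 * n%:R `^ b^-1.
have nb1 : 1 <= n%:R `^ b^-1 :> R.
  by rewrite -[leLHS](powRr0 n%:R) ler_powR// invr_ge0 ltW.
have M0M : M0 <= M by rewrite ler_peMr// ltW.
have M_gt0 : 0 < M by exact: lt_le_trans M0M.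
have mM0 : 0 < m * M `^ (b - 1) by rewrite mulr_gt0// powR_gt0.
(* Markov's inequality applied to h, which is at least m M^(b-1) outside [-M, M]. *)
have far_le j : (\int[P]_(w in A j) (1 - inball M (S j w))%:E <=
    (B1 / (m * M `^ (b - 1)))%:E)%E.
  apply: (@le_trans _ _ ((m * M `^ (b - 1))^-1%:E * \int[P]_(w in A j) h (S j w))%E).
    rewrite -ge0_integralZl//; last 3 first.
    - exact: measurable_alive.
    - exact: (@measurable_walk_comp _ _ _ _ mX x j h).
    - by rewrite lee_fin invr_ge0 ltW.
    apply: ge0_le_integral => //.
    - exact: measurable_alive.
    - by move=> w _; rewrite lee_fin subr_ge0 inballE lern1 leq_b1.
    - apply: (@measurable_walk_comp _ _ _ _ mX x j (fun y => (1 - inball M y)%:E)).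
      by apply/measurable_EFinP; exact: measurable_funB.
    - by apply: measurable_funeM; exact: (@measurable_walk_comp _ _ _ _ mX x j h).
    move=> w /(_ j (leqnn j)) aS; rewrite inballE.
    case: (leP _ M) => yM; first by rewrite subrr mule_ge0// lee_fin invr_ge0 ltW.
    rewrite /= subr0 -(@lee_pmul2l _ (m * M `^ (b - 1))%:E)// ?lte_fin//.
    rewrite muleA -!EFinM mulr1 divff ?gt_eqF// mul1e.
    apply: le_trans (hge _ _ _).
    - rewrite lee_fin ler_pM2l// ge0_ler_powR ?nnegrE ?(ltW M_gt0) ?(ltW bm1)//; exact: ltW.
    - exact: (E_neq0 aS).
    have : 2 / L <= `|S j w|.
      by rewrite ltW// (le_lt_trans _ yM)// (le_trans _ M0M)// le_max lexx orbT.
    by move=> LS; rewrite -[leRHS]invrK invf_div lef_pV2// posrE ?divr_gt0// (lt_trans M_gt0).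
  rewrite [X in (_ <= X%:E)%E]mulrC EFinM; apply: lee_pmul => //.
  - by rewrite lee_fin invr_ge0 ltW.
  - exact: integral_ge0.
  - by apply: (le_trans (integral_potential_le j)); rewrite lee_fin.
have sumP : ((n%:R)%:E * P (A n) <=
    (4 * M * B1 + n%:R * (B1 / (m * M `^ (b - 1))))%:E)%E.
  (* Survival is decreasing in time, so n P(A n) is at most the expected time alive before n, which
     is split at distance M. *)
  apply: (@le_trans _ _ (\sum_(j < n) P (A j))%E).
    have -> : ((n%:R)%:E * P (A n) = \sum_(j < n) P (A n))%E.
      rewrite -[P (A n)]fineK ?fin_num_measure//; last exact: measurable_alive.
      by rewrite sumEFin sumr_const card_ord -EFinM mulr_natl.
    apply: lee_sum => j _; apply: le_measure; rewrite ?inE; try exact: measurable_alive.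
    by move=> w h1 i ij; apply: h1; exact: leq_trans ij (ltnW (ltn_ord j)).
  apply: (@le_trans _ _ (\sum_(j < n) (\int[P]_(w in A j) (inball M (S j w))%:E +
     (B1 / (m * M `^ (b - 1)))%:E))%E).
    apply: lee_sum => j _.
    apply: (@le_trans _ _ (\int[P]_(w in A j) (inball M (S j w))%:E +
      \int[P]_(w in A j) (1 - inball M (S j w))%:E)%E); last by rewrite leeD2l.
    rewrite -ge0_integralD//; last 5 first.
    - exact: measurable_alive.
    - by move=> w _; rewrite lee_fin.
    - apply: (@measurable_walk_comp _ _ _ _ mX x j (fun y => (inball M y)%:E)).
      exact/measurable_EFinP.
    - by move=> w _; rewrite lee_fin subr_ge0 inballE lern1 leq_b1.
    - apply: (@measurable_walk_comp _ _ _ _ mX x j (fun y => (1 - inball M y)%:E)).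
      by apply/measurable_EFinP; exact: measurable_funB.
    under eq_integral do rewrite -EFinD subrKC.
    by rewrite integral_cst ?mul1e//; exact: measurable_alive.
  rewrite big_split/= EFinD; apply: leeD.
    have aM : a <= M by apply: le_trans M0M; rewrite le_max lexx.
    apply: (le_trans (green_near n aM)).
    by rewrite lee_fin ler_wpM2l// mulr_ge0// ltW.
  by rewrite sumEFin sumr_const card_ord mulr_natl.
rewrite -(@lee_pmul2l _ (n%:R)%:E)// ?lte_fin//; apply: (le_trans sumP).
rewrite -EFinM lee_fin le_eqVlt; apply/orP; left; apply/eqP.
have e1 : n%:R * n%:R `^ (b^-1 - 1) = n%:R `^ b^-1 :> R.
  by rewrite mulr_powRB1// invr_gt0.
have e2 : n%:R = n%:R `^ b^-1 * (n%:R `^ b^-1) `^ (b - 1) :> R.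
  rewrite mulr_powRB1// -powRrM mulVf ?powRr1// gt_eqF//.
rewrite [RHS]mulrCA e1 /M powRM ?powR_ge0 ?(ltW M00)//.
rewrite [X in _ + X * (B1 / _)]e2.
have g1 : (n%:R `^ b^-1) `^ (b - 1) != 0 :> R.
  by rewrite gt_eqF// powR_gt0// powR_gt0.
have g2 : M0 `^ (b - 1) != 0 by rewrite gt_eqF// powR_gt0.
have mm : m != 0 by rewrite gt_eqF.
by field; rewrite g1 g2 mm.
Qed.

End survival_upper_bound.

(** * Lower bound for the survival probability *)

Section survival_lower_bound.
Context (R : realType) (d : measure_display) (T : measurableType d).
Variables (P : probability T R) (X : nat -> T -> R) (mu : probability R R).
Hypothesis mX : forall n, measurable_fun setT (X n).
Hypothesis indX : mutually_independent P X.
Hypothesis lawX : forall n B, measurable B -> P (X n @^-1` B) = mu B.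
Hypothesis mu_sym : forall B : set R, measurable B -> mu (-%R @^-1` B) = mu B.
(** The potential h lies between orders b - 1 and th, which needs gamma - 1 < th. The power
    potential g has order at least s; s < 2 makes it finite and s < b makes its drift bounded. *)
Variables (gamma k C b th s : R).
Hypothesis gamma12 : 1 < gamma <= 2.
Hypothesis k0 : 0 < k.
Hypothesis psi_ge : forall t, 0 < t -> k * Num.min t 1 `^ gamma <= one_minus_cf mu t.
Hypothesis C0 : 0 < C.
Hypothesis b1 : 1 < b.
Hypothesis psi_le : forall t, one_minus_cf mu t <= C * `|t| `^ b.
Hypothesis th_gt : gamma - 1 < th.
Hypothesis th_lt : th < s.
Hypothesis s_lt : s < b.
Hypothesis s_lt2 : s < 2.
Variables (x a : R).
Hypothesis a0 : 0 < a.
Local Notation leb := (@lebesgue_measure R).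
Local Notation psi := (one_minus_cf mu).
Local Notation S := (walk X x).

(* The condition at time 1 forces the walk to start far away, where the
   potential exceeds its maximum on [-a, a]. *)
Definition far_start (r : R) (n : nat) : set R := outside (if n == 1%N then r else a).

Let th0 : 0 < th.
Proof. by case/andP: gamma12 => g1 _; apply: lt_trans th_gt; rewrite subr_gt0. Qed.

Let s0 : 0 < s. Proof. exact: lt_trans th_lt. Qed.

Let psi_ge2 t : 0 < t -> k * Num.min t 1 `^ 2 <= psi t.
Proof.
move=> t0; apply: le_trans (psi_ge t0); rewrite ler_pM2l//.
have m0 : 0 < Num.min t 1 by rewrite lt_min t0/=.
by apply: ger_powR; [rewrite m0 ge_min lexx orbT|case/andP: gamma12].
Qed.

Let psi_gt0 t : 0 < t -> 0 < psi t.
Proof. exact: (one_minus_cf_gt0 k0 psi_ge2). Qed.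

Let q (t : R) := tent 1 t / psi t.

Let q0 t : 0 <= q t.
Proof. by rewrite divr_ge0 ?tent_ge0// one_minus_cf_ge0. Qed.

Let mq : measurable_fun setT q.
Proof. by apply: measurable_div_one_minus_cf; exact: measurable_tent. Qed.

Let h := potential q.

Let h0 y : (0 <= h y)%E. Proof. exact: potential_ge0. Qed.

Let mh : measurable_fun setT h. Proof. exact: measurable_potential. Qed.

Let h_le : exists2 C1 : R, 0 <= C1 & forall z, (h z <= (C1 * `|z| `^ th)%:E)%E.
Proof.
apply: (@potential_le _ q 1 k^-1 gamma th mq) => //.
- by rewrite invr_ge0 ltW.
- by rewrite !ltW// (lt_trans th_lt).
- by rewrite ltrBlDl -ltrBlDr.
- by move=> t /negbTE t1; rewrite /q tentE t1 mul0r.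
- move=> t /andP[t0 t1].
  have := psi_ge t0; rewrite (min_l t1) => pt.
  apply: (@le_trans _ _ (psi t)^-1).
    by rewrite /q ler_piMl ?tent_le1// invr_ge0 one_minus_cf_ge0.
  by rewrite powRN -invfM lef_pV2 ?posrE ?psi_gt0// mulr_gt0// powR_gt0.
Qed.

Let m := (2 * C)^-1 / 32.

Let m0 : 0 < m. Proof. by rewrite divr_gt0// invr_gt0 mulr_gt0. Qed.

Let h_ge z : z != 0 -> `|z|^-1 <= 1 / 2 -> ((m * `|z| `^ (b - 1))%:E <= h z)%E.
Proof.
exact: (tent_potential_ge k0 psi_ge2 ltr01 C0 (ltW (lt_trans ltr01 b1)) psi_le).
Qed.

(** Over ]0, +oo[ the weight t^(-1-s) would give a multiple of |z|^s; the cut at 1 keeps this order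
    from below for |z| >= 1. *)
Let qs (t : R) := \1_`]0, 1] t * t `^ (- (1 + s)).

Let qsE t : qs t = if 0 < t <= 1 then t `^ (- (1 + s)) else 0.
Proof.
by rewrite /qs indicE mem_setE in_itv/=; case: ifP; rewrite ?mul1r ?mul0r.
Qed.

Let qs0 t : 0 <= qs t.
Proof. by rewrite qsE; case: ifP => // _; exact: powR_ge0. Qed.

Let mqs : measurable_fun setT qs.
Proof.
apply: measurable_funM; first exact: measurable_indic.
exact: measurable_powR.
Qed.

Let g := potential qs.

Let g0 y : (0 <= g y)%E. Proof. exact: potential_ge0. Qed.

Let mg : measurable_fun setT g. Proof. exact: measurable_potential. Qed.

Let g_lty y : (g y < +oo)%E.
Proof.
have [||||||||K K0 hK] := @potential_le _ qs 1 1 (1 + s) 2.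
- exact: mqs.
- exact: ltr01.
- exact: ler01.
- by rewrite lexx ler0n.
- by have := s_lt2; lra.
- exact: qs0.
- by move=> t /negbTE t1; rewrite qsE t1.
- by move=> t t1; rewrite qsE t1 mul1r.
exact: le_lt_trans (hK y) (ltry _).
Qed.

Let g_ge z : 1 <= `|z| -> ((32^-1 * `|z| `^ s)%:E <= g z)%E.
Proof.
move=> z1; have nz0 : 0 < `|z| by exact: lt_le_trans z1.
have -> : 32^-1 * `|z| `^ s = 1 / 32 * `|z| `^ (1 + s - 1).
  by rewrite div1r [1 + s]addrC addrK.
apply: (@potential_ge _ qs 1) => //.
- by rewrite addr_ge0// ltW.
- by move=> t t1; rewrite qsE t1 mul1r.
- by rewrite -normr_gt0.
- by rewrite invf_le1.
Qed.

Let qs_psi_integrable : leb.-integrable setT (fun t => (qs t * psi t)%:E).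
Proof.
have mqp : measurable_fun setT (fun t => qs t * psi t).
  by apply: measurable_funM => //; exact: measurable_one_minus_cf.
apply/integrableP; split; first exact/measurable_EFinP.
apply: (@le_lt_trans _ _
    (C%:E * \int[leb]_(t in `]0%R, 1%R]) (t `^ (- (1 + s - b)))%:E)%E); last first.
  apply: lte_mul_pinfty => //; first by rewrite lee_fin ltW.
  by apply: integral_inv_powR_lty => //; have := s_lt; lra.
rewrite -ge0_integralZl//; last 3 first.
- by apply/measurable_EFinP; apply: measurable_funTS; exact: measurable_powR.
- by move=> t _; rewrite lee_fin powR_ge0.
- by rewrite lee_fin ltW.
rewrite [leRHS]integral_mkcond; apply: ge0_le_integral => //.
- by apply: measurableT_comp => //; exact/measurable_EFinP.
- apply: (iffLR (measurable_restrictT _ _)) => //; apply: measurable_funeM.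
  by apply/measurable_EFinP; apply: measurable_funTS; exact: measurable_powR.
move=> t _; rewrite patchE mem_setE in_itv/= qsE.
case: ifPn => [/andP[t0 t1]|_]; last by rewrite mul0r normr0.
rewrite ger0_norm ?mulr_ge0 ?powR_ge0 ?one_minus_cf_ge0// lee_fin.
have -> : - (1 + s - b) = - (1 + s) + b by ring.
rewrite powRD; last by rewrite (gt_eqF t0) implybT.
rewrite mulrCA ler_wpM2l ?powR_ge0//.
by have := psi_le t; rewrite gtr0_norm.
Qed.

Let Cs := fine (\int[leb]_t (qs t * psi t)%:E)%E.

Let Cs0 : 0 <= Cs.
Proof.
apply: fine_ge0; apply: integral_ge0 => t _.
by rewrite lee_fin mulr_ge0// one_minus_cf_ge0.
Qed.

Let g_drift z : (\int[mu]_y g (z + y)%R <= g z + Cs%:E)%E.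
Proof.
rewrite /g (potential_drift mu_sym)//; apply: leeD => //.
rewrite /Cs fineK; last by apply: integrable_fin_num.
have mqp : measurable_fun setT (fun t => qs t * psi t).
  by apply: measurable_funM => //; exact: measurable_one_minus_cf.
apply: le_integral => //.
  apply: (le_integrable _ _ _ qs_psi_integrable) => //.
    apply/measurable_EFinP; apply: measurable_funM => //.
    by under eq_fun do rewrite mulrC; exact: measurable_cosM.
  by move=> t _; rewrite /= lee_fin [leLHS]normrM ler_piMr// cos_max.
move=> t _; rewrite lee_fin ler_piMr ?cos_le1// mulr_ge0// one_minus_cf_ge0//.
Qed.

Section fixed_start.
Variables (r : R).
Hypothesis ar : a <= r.
Local Notation D := (far_start r).
Local Notation A := (alive X x D).

Let mD n : measurable (D n). Proof. exact: measurable_outside. Qed.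

Let mA n : measurable (A n). Proof. exact: measurable_alive. Qed.

Let D_outside n : D n `<=` outside a.
Proof.
move=> y; rewrite /far_start /outside/=; case: ifP => // _.
exact: le_lt_trans.
Qed.

Let D_neq0 n y : D n y -> y != 0.
Proof. by move=> /D_outside ay; rewrite -normr_gt0 (lt_trans a0). Qed.

Let p n := fine (P (A n)).

Let pE n : P (A n) = (p n)%:E.
Proof. by rewrite fineK// fin_num_measure. Qed.

Let p0 n : 0 <= p n. Proof. exact: fine_ge0. Qed.

Let A_le i j : (i <= j)%N -> A j `<=` A i.
Proof. by move=> ij w h1 l li; apply: h1; exact: leq_trans ij. Qed.

Let p_le i j : (i <= j)%N -> p j <= p i.
Proof.
move=> ij; rewrite -lee_fin -!pE; apply: le_measure; rewrite ?inE//.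
exact: A_le.
Qed.

Let integral_A_cst n (c : R) : (\int[P]_(w in A n) (cst c%:E) w = (c * p n)%:E)%E.
Proof. by rewrite integral_cst// EFinM -pE. Qed.

Let u n := fine (\int[P]_(w in A n) h (S n w))%E.

Let tent1 : (fun t => tent 1 t / psi t) = q. Proof. by []. Qed.

Let h_drift z : z != 0 ->
  (\int[mu]_y h (z + y)%R = h z + (fejer 1 z)%:E)%E.
Proof. by move=> z0; rewrite /h -tent1 (tent_potential_drift mu_sym k0 psi_ge2). Qed.

(** Finite because h x is finite and the drift is at most 2/a^2 outside [-a, a], where the walk
    stays for n steps. *)
Let uE n : (\int[P]_(w in A n) h (S n w) = (u n)%:E)%E.
Proof.
rewrite fineK// ge0_fin_numE; last by apply: integral_ge0.
have [C1 _ hC1] := h_le.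
have c20 (y : R) : (0 <= (2 / a ^+ 2)%:E :> \bar R)%E.
  by rewrite lee_fin divr_ge0// sqr_ge0.
have drift j z : D j z -> (\int[mu]_y h (z + y)%R + 0 <= h z + (2 / a ^+ 2)%:E)%E.
  move=> Dz; rewrite adde0 h_drift ?(D_neq0 Dz)// leeD2l// lee_fin.
  apply: (le_trans (fejer_le z ltr01)); rewrite divr1.
  have az : a < `|z| := D_outside Dz.
  have az2 : a ^+ 2 < z ^+ 2.
    by rewrite -[z ^+ 2]real_normK ?num_real// ltr_sqr ?nnegrE ?(ltW a0).
  have a20 : 0 < a ^+ 2 by rewrite exprn_gt0.
  have z20 : 0 < z ^+ 2 by exact: lt_trans az2.
  by rewrite ler_pM2l// lef_pV2 ?posrE// ltW.
have := killed_sum mX indX lawX x mD n h0 (fun=> lexx 0%E) c20 mh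
  (measurable_cst _) (measurable_cst _) drift.
move=> ks; apply: le_lt_trans (le_trans _ ks) _.
  by rewrite leeDl//; apply: sume_ge0 => i _; apply: integral_ge0.
under eq_bigr do rewrite integral_A_cst.
rewrite sumEFin; apply: lte_add_pinfty; last exact: ltry.
exact: le_lt_trans (hC1 x) (ltry _).
Qed.

(** The drift of h is nonnegative, so potential is lost only by exiting. For n > 0 an exit at time n
    + 1 lands in [-a, a], where h <= C1 a^th; subtracting that multiple of p gives a nondecreasing
    sequence. *)
Let u_step C1 n : (0 < n)%N -> 0 <= C1 ->
  (forall z, (h z <= (C1 * `|z| `^ th)%:E)%E) ->
  u n - C1 * a `^ th * p n <= u n.+1 - C1 * a `^ th * p n.+1.
Proof.
move=> n0 C10 hC1; set H := C1 * a `^ th.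
have H0 : 0 <= H by rewrite mulr_ge0// powR_ge0.
have mhS j B : measurable_fun B (fun w => h (S j w)).
  exact: measurable_walk_comp.
suff : ((u n)%:E <= (u n.+1)%:E + (H * (p n - p n.+1))%:E)%E.
  by rewrite -EFinD lee_fin mulrBr; lra.
apply: (@le_trans _ _ (\int[P]_(w in A n) h (S n.+1 w))%E).
  rewrite (integral_alive_step mX indX lawX x mD)// -uE.
  apply: ge0_le_integral => //.
  - have mint := measurable_integral_shift mu h0 mh.
    exact: (@measurable_walk_comp _ _ _ _ mX x n _ (A n) mint).
  move=> w /(_ n (leqnn n))/D_neq0 S0; rewrite h_drift// leeDl// lee_fin.
  exact: fejer_ge0.
have mAD : measurable (A n `\` A n.+1) by exact: measurableD.
have AU : A n = A n.+1 `|` (A n `\` A n.+1).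
  by rewrite setDUK//; exact: A_le.
rewrite {1}AU ge0_integral_setU//; last by apply/disj_set2P; rewrite setDIK.
rewrite uE; apply: leeD => //.
apply: (@le_trans _ _ (\int[P]_(w in A n `\` A n.+1) (cst H%:E) w)%E).
  apply: ge0_le_integral => //.
  move=> w [Aw nAw]; apply: (le_trans (hC1 _)); rewrite lee_fin ler_wpM2l//.
  rewrite ge0_ler_powR ?nnegrE ?(ltW th0) ?(ltW a0)//.
  rewrite leNgt; apply/negP => aS; apply: nAw; rewrite aliveS; split => //.
  by rewrite /far_start eqSS (gtn_eqF n0).
have PD : P (A n `\` A n.+1) = (p n - p n.+1)%:E.
  have e : A n `&` A n.+1 = A n.+1 by rewrite setIidr//; exact: A_le.
  have Pn : (P (A n) < +oo)%E by rewrite pE ltry.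
  transitivity (P (A n) - P (A n `&` A n.+1))%E; last by rewrite e !pE EFinB.
  exact: measureD.
by rewrite integral_cst// [leRHS]EFinM -PD.
Qed.

(** The assumption refuted concerns sums because the bounded drift of g accumulates exactly such a
    sum, and a moment of the hitting time bounds it with no logarithm at e = 1. *)
Lemma survival_far_start C1 : 0 <= C1 ->
  (forall z, (h z <= (C1 * `|z| `^ th)%:E)%E) ->
  (forall z, r < `|z| -> ((C1 * a `^ th + 1)%:E <= h z)%E) ->
  (0 < P (A 1%N))%E -> forall K e, th / s < e -> e <= 1 ->
  ~ (forall n, (0 < n)%N -> (\sum_(j < n) P (A j) <= (K * n%:R `^ (1 - e))%:E)%E).
Proof.
move=> C10 hC1 hr p10 K e se e1 hK.
have p1 : 0 < p 1%N by rewrite -lte_fin -pE.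
set H := C1 * a `^ th in hr.
have H0 : 0 <= H by rewrite mulr_ge0// powR_ge0.
(* As h >= H + 1 on A 1, the sequence u n - H p n starts at a value of at least p 1, and it never
   decreases. *)
have u1 n : (0 < n)%N -> p 1%N <= u n.
  move=> n0; apply: (@le_trans _ _ (u n - H * p n)); last first.
    by rewrite gerBl mulr_ge0.
  case: n n0 => // n _; elim: n => [|n IH]; last first.
    by apply: (le_trans IH); exact: u_step.
  rewrite lerBrDr -{1}[p 1%N]mul1r -mulrDl -lee_fin addrC -uE -integral_A_cst.
  apply: ge0_le_integral => //.
  - by move=> w _; rewrite lee_fin addr_ge0.
  - exact: measurable_walk_comp.
  by move=> w /(_ 1%N (leqnn 1)) rS; exact: hr.
(* Interpolation at a threshold N: beyond it |y|^th <= N^(th-s) |y|^s, and |y|^s is at most 32 g. *)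
have hg N y : 1 <= N ->
    (h y <= (C1 * N `^ th)%:E + (32 * C1 * N `^ (th - s))%:E * g y)%E.
  move=> N1; have N0 : 0 < N by exact: lt_le_trans N1.
  have c0 : 0 <= 32 * C1 * N `^ (th - s) by rewrite !mulr_ge0// powR_ge0.
  have [yN|Ny] := leP `|y| N.
    apply: (le_trans (hC1 y)); apply: (@le_trans _ _ (C1 * N `^ th)%:E).
      by rewrite lee_fin ler_wpM2l// ge0_ler_powR ?nnegrE ?(ltW th0) ?(ltW N0).
    by rewrite leeDl// mule_ge0.
  have y0 : 0 < `|y| by exact: lt_trans Ny.
  apply: (le_trans (hC1 y)).
  apply: (@le_trans _ _ ((32 * C1 * N `^ (th - s))%:E * (32^-1 * `|y| `^ s)%:E)%E).
    rewrite -EFinM lee_fin.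
    have -> : 32 * C1 * N `^ (th - s) * (32^-1 * `|y| `^ s) =
        C1 * (N `^ (th - s) * `|y| `^ s) by field.
    rewrite ler_wpM2l//.
    have -> : th = (th - s) + s by ring.
    rewrite powRD; last by rewrite (gt_eqF y0) implybT.
    rewrite addrK ler_wpM2r ?powR_ge0// -opprB !powRN lef_pV2 ?posrE ?powR_gt0//.
    by rewrite ge0_ler_powR ?nnegrE ?subr_ge0 ?(ltW th_lt) ?(ltW N0) ?(ltW Ny) ?(ltW y0).
  apply: (@le_trans _ _ ((32 * C1 * N `^ (th - s))%:E * g y)%E).
    by apply: lee_wpmul2l => //; apply: g_ge; apply: le_trans N1 (ltW Ny).
  by rewrite leeDr// lee_fin mulr_ge0// powR_ge0.
pose G := fine (g x).
have G0 : 0 <= G by exact: fine_ge0.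
have gE : g x = G%:E by rewrite fineK// ge0_fin_numE.
have K0 : 0 <= K.
  rewrite -lee_fin; have := hK 1%N (ltnSn 0); rewrite powR1 mulr1.
  by apply: le_trans; apply: sume_ge0.
have sump n : (0 < n)%N -> \sum_(j < n) p j <= K * n%:R `^ (1 - e).
  move=> n0; rewrite -lee_fin -sumEFin; under eq_bigr do rewrite -pE.
  exact: hK.
have gn n : (0 < n)%N ->
    (\int[P]_(w in A n) g (S n w) <= (G + Cs * (K * n%:R `^ (1 - e)))%:E)%E.
  move=> n0.
  have cs0 (y : R) : (0 <= Cs%:E :> \bar R)%E by rewrite lee_fin.
  have drift j z : D j z -> (\int[mu]_y g (z + y)%R + 0 <= g z + Cs%:E)%E.
    by rewrite adde0 => _; exact: g_drift.
  have := killed_sum mX indX lawX x mD n g0 (fun=> lexx 0%E) cs0 mg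
    (measurable_cst _) (measurable_cst _) drift.
  move=> ks; apply: le_trans (le_trans _ ks) _.
    by rewrite leeDl//; apply: sume_ge0 => i _; apply: integral_ge0.
  rewrite gE EFinD leeD2l//; under eq_bigr do rewrite integral_A_cst.
  by rewrite sumEFin lee_fin -mulr_sumr ler_wpM2l// sump.
have un n (N : R) : (0 < n)%N -> 1 <= N ->
    u n <= C1 * N `^ th * p n +
      32 * C1 * N `^ (th - s) * (G + Cs * (K * n%:R `^ (1 - e))).
  move=> n0 N1.
  have c0 : 0 <= 32 * C1 * N `^ (th - s) by rewrite !mulr_ge0// powR_ge0.
  have c1 : 0 <= C1 * N `^ th by rewrite mulr_ge0// powR_ge0.
  rewrite -lee_fin -uE.
  apply: (@le_trans _ _ (\int[P]_(w in A n) ((C1 * N `^ th)%:E +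
      (32 * C1 * N `^ (th - s))%:E * g (S n w)))%E).
    apply: ge0_le_integral => //.
    - exact: measurable_walk_comp.
    - apply: emeasurable_funD => //; apply: measurable_funeM.
      exact: measurable_walk_comp.
    by move=> w _; exact: hg.
  rewrite ge0_integralD//; last 2 first.
  - by move=> w _; rewrite mule_ge0.
  - by apply: measurable_funeM; exact: measurable_walk_comp.
  rewrite EFinD; apply: leeD; first by rewrite integral_A_cst.
  rewrite ge0_integralZl//; last exact: measurable_walk_comp.
  rewrite [leRHS]EFinM; apply: lee_wpmul2l; first by rewrite lee_fin.
  exact: gn.
pose K2 := C1 * K + 32 * C1 * (G + Cs * K).
have K20 : 0 <= K2.
  by rewrite /K2 addr_ge0 ?mulr_ge0// addr_ge0// mulr_ge0.
have key n : (0 < n)%N -> p 1%N <= K2 * n%:R `^ (th / s - e).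
  move=> n0; have n1 : 1 <= n%:R :> R by rewrite ler1n.
  have n0R : 0 < n%:R :> R by rewrite ltr0n.
  have n00 : (n%:R == 0 :> R) = false by rewrite gt_eqF.
  (* This balances N^th n^(-e) with N^(th-s) n^(1-e); both become n^(th/s - e). *)
  pose N : R := n%:R `^ s^-1.
  have N1 : 1 <= N.
    by rewrite -[leLHS](powRr0 n%:R) ler_powR// invr_ge0 ltW.
  apply: (le_trans (u1 n n0)); apply: (le_trans (un n N n0 N1)).
  have NthE : N `^ th = n%:R `^ (th / s) by rewrite -powRrM mulrC.
  have NthsE : N `^ (th - s) = n%:R `^ (th / s - 1).
    by rewrite -powRrM; congr (_ `^ _); field; rewrite gt_eqF.
  have pn : p n <= K * n%:R `^ (- e).
    have : n%:R * p n <= K * n%:R `^ (1 - e).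
      apply: le_trans (sump n n0).
      rewrite mulr_natl -[n in _ *+ n]card_ord -sumr_const.
      by apply: ler_sum => j _; apply: p_le; exact: ltnW.
    rewrite powRD ?n00 ?implybT// powRr1 ?(ltW n0R)// mulrCA.
    by rewrite ler_pM2l.
  have e3 : n%:R `^ (th / s - e) = n%:R `^ (th / s) * n%:R `^ (- e) :> R.
    by rewrite powRD ?n00 ?implybT.
  have e2 : n%:R `^ (th / s - 1) * n%:R `^ (1 - e) = n%:R `^ (th / s - e) :> R.
    by rewrite -powRD ?n00 ?implybT//; congr (_ `^ _); ring.
  (* The initial value G of g comes with the exponent th/s - 1, absorbed because e <= 1. *)
  have le1 : n%:R `^ (th / s - 1) <= n%:R `^ (th / s - e) :> R.
    by rewrite ler_powR// lerD2l lerN2.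
  rewrite /K2 NthE NthsE (mulrDl (C1 * K)); apply: lerD.
    rewrite e3 -!mulrA ler_wpM2l// mulrCA ler_wpM2l ?powR_ge0//.
  rewrite -!mulrA ler_wpM2l// ler_wpM2l// (mulrDr (n%:R `^ _)) (mulrDl G); apply: lerD.
    by rewrite mulrC ler_wpM2l.
  by rewrite mulrC -!mulrA [n%:R `^ (1 - e) * _]mulrC e2.
have e0 : 0 < e - th / s by rewrite subr_gt0.
have [n n0] := powRN_decay K20 p1 e0.
by rewrite opprB ltNge key.
Qed.

End fixed_start.

Lemma survival_sum_large : exists2 r : R, a <= r &
  (0 < P (alive X x (far_start r) 1%N))%E -> forall K e, th / s < e -> e <= 1 ->
  ~ (forall n, (0 < n)%N ->
       (\sum_(j < n) P (alive X x (far_start r) j) <= (K * n%:R `^ (1 - e))%:E)%E).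
Proof.
have [C1 C10 hC1] := h_le.
have bm1 : 0 < b - 1 by rewrite subr_gt0.
pose H := C1 * a `^ th.
have H0 : 0 <= H by rewrite mulr_ge0// powR_ge0.
have H1 : 0 <= (H + 1) / m by rewrite divr_ge0 ?addr_ge0// ltW.
pose r1 := ((H + 1) / m) `^ (b - 1)^-1.
(* Beyond r1 the lower bound on h exceeds H + 1; that bound is valid for |z| >= 2. *)
exists (Num.max (Num.max a 2) r1); first by rewrite !le_max lexx.
apply: (survival_far_start _ C10 hC1); first by rewrite !le_max lexx.
move=> z; rewrite !gt_max => /andP[/andP[az z2] rz].
have z0 : 0 < `|z| by exact: lt_trans az.
apply: le_trans (h_ge _ _).
- rewrite lee_fin -ler_pdivrMl// mulrC.
  have -> : (H + 1) / m = r1 `^ (b - 1).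
    by rewrite -powRrM mulVf ?gt_eqF// powRr1.
  by rewrite ge0_ler_powR ?nnegrE ?powR_ge0 ?(ltW bm1) ?(ltW z0)// ltW.
- by rewrite -normr_gt0.
- by rewrite div1r lef_pV2 ?posrE// ltW.
Qed.

End survival_lower_bound.

(** * Moments of the hitting time *)

Section hitting_time_facts.
Context (R : realType) (T : Type) (Z : nat -> T -> R) (a : R).
Local Notation tau := (hitting_time Z a).

Lemma hitting_timeP w :
  (tau w = +oo%E /\ forall n, a < `|Z n w|) \/
  exists n, [/\ tau w = n%:R%:E, `|Z n w| <= a & forall k, (k < n)%N -> a < `|Z k w|].
Proof.
have [[n0 hn0]|none] := pselect (exists n, `|Z n w| <= a); last first.
  left; split; last first.
    by move=> n; rewrite ltNge; apply/negP => h; apply: none; exists n.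
  by apply/ereal_inf_pinfty => t [n /= hn _]; exfalso; apply: none; exists n.
right; have ex : exists n, `|Z n w| <= a by exists n0.
case: (ex_minnP ex) => n hn nmin; exists n; split => //.
- apply/eqP; rewrite eq_le; apply/andP; split.
    by apply: ereal_inf_lbound; exists n.
  apply: le_ereal_inf_tmp => _ [j /= hj <-]; rewrite lee_fin ler_nat.
  exact: nmin.
- move=> j jn; rewrite ltNge; apply/negP => /nmin.
  by rewrite leqNgt jn.
Qed.

Lemma hitting_time_ge0 w : (0 <= tau w)%E.
Proof.
by case: (hitting_timeP w) => [[-> _]|[n [-> _ _]]]; rewrite ?leey// lee_fin.
Qed.

End hitting_time_facts.

Lemma measurable_hitting_time (R : realType) d (T : measurableType d)
    (Z : nat -> T -> R) (a : R) :
  (forall n, measurable_fun setT (Z n)) -> measurable_fun setT (hitting_time Z a).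
Proof.
move=> mZ.
pose f (n : nat) w : \bar R := if `|Z n w| <= a then n%:R%:E else +oo%E.
have mf n : measurable_fun setT (f n).
  apply: measurable_fun_ifT => //.
  apply: measurable_fun_ler => //.
  by apply: measurableT_comp (mZ n); exact: normr_measurable.
rewrite (_ : hitting_time Z a = (fun w => einfs (f ^~ w) 0)).
  exact: measurable_fun_einfs.
apply/funext => w; apply/eqP; rewrite eq_le; apply/andP; split.
  apply: le_ereal_inf_tmp => _ [n _ <-]; rewrite /f; case: ifP => [Zn|_].
    by apply: ereal_inf_lbound; exists n.
  exact: leey.
apply: le_ereal_inf_tmp => _ [n /= Zn <-].
by apply: ereal_inf_lbound; exists n => //; rewrite /f Zn.
Qed.

Section hitting_moments.
Context (R : realType) (d : measure_display) (T : measurableType d).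
Variables (P : probability T R) (Z : nat -> T -> R) (a : R).
Hypothesis mZ : forall n, measurable_fun setT (Z n).
Local Notation tau := (hitting_time Z a).
Local Notation Alive n := [set w | forall k, (k <= n)%N -> a < `|Z k w|].

Let mtau : measurable_fun setT tau.
Proof. exact: measurable_hitting_time. Qed.

Let mpow (q : R) : measurable_fun setT (fun w => (tau w `^ q)%E).
Proof. by apply: (measurableT_comp (measurable_poweR q)). Qed.

Let mAlive n : measurable (Alive n).
Proof.
rewrite (_ : Alive n = \bigcap_(k in [set k | (k <= n)%N]) Z k @^-1` outside a)//.
apply: bigcap_measurableType => k _.
by rewrite -[X in measurable X]setTI; apply: mZ => //; exact: measurable_outside.
Qed.

Lemma hitting_moment_lty_gt0 (K p q : R) : 0 <= K -> 0 < q -> q < p ->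
  (forall n, (0 < n)%N -> (P (Alive n) <= (K * n%:R `^ (- p))%:E)%E) ->
  (hitting_moment P Z a q < +oo)%E.
Proof.
move=> K0 q0 qp hP.
have p0 : 0 < p by exact: lt_trans qp.
have mfine : measurable_fun setT (fine \o tau) by exact: measurableT_comp.
have shell (j : nat) :
    (P (setT `&` [set w | 2 ^+ j < fine (tau w) <= 2 ^+ j.+1]%R) <=
     (K * (2 ^+ j) `^ (- p))%:E)%E.
  apply: (@le_trans _ _ (P (Alive (2 ^ j)%N))); last first.
    by rewrite -natrX; apply: hP; rewrite expn_gt0.
  apply: le_measure; rewrite ?inE//.
    rewrite (_ : [set w | _] = (fine \o tau) @^-1` `]2 ^+ j, 2 ^+ j.+1]).
      exact: mfine.
    by apply/seteqP; split => w /=; rewrite in_itv.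
  move=> w [_ /andP[jt _]] k kj.
  case: (hitting_timeP Z a w) => [[_ h]|[n [tn _ h]]]; first exact: h.
  by apply: h; rewrite tn/= -natrX ltr_nat in jt; exact: leq_ltn_trans jt.
have fin : (\int[P]_w (fine (tau w) `^ q)%:E < +oo)%E.
  apply: (@dyadic_moment _ _ _ P setT (fine \o tau) K p q) => //.
  - by move=> w _; rewrite /= fine_ge0// hitting_time_ge0.
  - by rewrite (le_lt_trans (probability_le1 _ _)) ?ltry.
  - exact: ltW.
have mI : measurable [set w | tau w = +oo%E].
  have := mtau measurableT (emeasurable_set1 +oo%E).
  by rewrite setTI.
(* [fine] sends +oo to 0, so the moment of [fine \o tau] is that of tau only once the event tau =
   +oo is null. *)
have tau_fin : {ae P, forall w, tau w \is a fin_num}.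
  exists [set w | tau w = +oo%E]; split.
  - exact: mI.
  - apply/eqP; rewrite eq_le measure_ge0 andbT.
    have PE : P [set w | tau w = +oo%E] = (fine (P [set w | tau w = +oo%E]))%:E.
      by rewrite fineK// fin_num_measure.
    rewrite PE lee_fin leNgt; apply/negP => r0.
    set r := fine _ in PE r0.
    have rn n : (0 < n)%N -> r <= K * n%:R `^ (- p).
      move=> n0; rewrite -lee_fin -PE; apply: le_trans (hP n n0).
      apply: le_measure; rewrite ?inE// => w /= tw k _.
      by case: (hitting_timeP Z a w) => [[_ h]|[m [tm _ _]]] //; rewrite tm in tw.
    have [n n0] := powRN_decay K0 r0 p0.
    by rewrite ltNge rn.
  - move=> w /= /negP; case: (hitting_timeP Z a w) => [[-> _]//|[n [-> _ _]]].
    by rewrite fin_numE.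
rewrite /hitting_moment (@ae_eq_integral _ _ _ P setT
  (fun w => (fine (tau w) `^ q)%:E))//.
- apply/measurable_EFinP; apply: (measurableT_comp (measurable_powR q)).
  exact: mfine.
apply: filterS tau_fin => w tw _.
by rewrite -{1}(fineK tw) poweR_EFin.
Qed.

(** For q <= 0, tau^q <= 1 + tau^(p/2). This holds at tau = +oo because the right side is infinite
    there, and at tau = 0 because [powR] of 0 is 0 or 1. *)
Lemma hitting_moment_lty (K p q : R) : 0 <= K -> 0 < p -> q < p ->
  (forall n, (0 < n)%N -> (P (Alive n) <= (K * n%:R `^ (- p))%:E)%E) ->
  (hitting_moment P Z a q < +oo)%E.
Proof.
move=> K0 p0 qp hP; have [q0|q0] := ltP 0 q; first exact: hitting_moment_lty_gt0 hP.
have p2 : 0 < p / 2 by rewrite divr_gt0.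
have p2p : p / 2 < p by rewrite ltr_pdivrMr// ltr_pMr// ltr1n.
have fin := hitting_moment_lty_gt0 K0 p2 p2p hP.
apply: (@le_lt_trans _ _ (\int[P]_w (1%:E + tau w `^ (p / 2)))%E).
  apply: ge0_le_integral => //.
  - by move=> w _; exact: poweR_ge0.
  - exact: emeasurable_funD.
  move=> w _; case: (hitting_timeP Z a w) => [[-> _]|[n [-> _ _]]].
    by rewrite [X in (_ + X)%E]poweRyr ?gt_eqF// leey.
  rewrite !poweR_EFin -EFinD lee_fin; case: n => [|n].
    rewrite /powR eqxx; move: (ler0n R (p / 2 == 0)).
    by case: (q == 0) => /=; rewrite ?mulr0n ?mulr1n; lra.
  apply: (@le_trans _ _ 1); last by rewrite lerDl powR_ge0.
  by rewrite -[leRHS](powRr0 n.+1%:R) ler_powR// ler1n.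
rewrite ge0_integralD//; last by move=> w _; exact: poweR_ge0.
apply: lte_add_pinfty => //.
by rewrite integral_cst// mul1e (le_lt_trans (probability_le1 _ _)) ?ltry.
Qed.

(** The sum is at most E[min(tau, n)], and l = min(tau, n) satisfies l = l^(1-e) l^e <= n^(1-e)
    tau^q. *)
Lemma survival_sum_le (B : nat -> set T) (q e : R) (n : nat) :
  (forall j, measurable (B j)) ->
  (forall j w, B j w -> forall k, (k <= j)%N -> a < `|Z k w|) ->
  0 < e -> e <= q -> e <= 1 -> (0 < n)%N ->
  (\sum_(j < n) P (B j) <= (n%:R `^ (1 - e))%:E * hitting_moment P Z a q)%E.
Proof.
move=> mB hB e0 eq e1 n0.
have n1 : 1 <= n%:R :> R by rewrite ler1n.
rewrite /hitting_moment -ge0_integralZl//; last by move=> w _; exact: poweR_ge0.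
have -> : (\sum_(j < n) P (B j) = \int[P]_w \sum_(j < n) (\1_(B j) w)%:E)%E.
  rewrite ge0_integral_sum//; last first.
    by move=> j; apply/measurable_EFinP.
  by apply: eq_bigr => j _; rewrite integral_indic// setIT.
apply: ge0_le_integral => //.
- by move=> w _; apply: sume_ge0.
- by apply: emeasurable_sum => j; exact/measurable_EFinP.
- by apply: measurable_funeM; exact: mpow.
move=> w _; rewrite sumEFin.
case: (hitting_timeP Z a w) => [[-> _]|[m [-> Zm _]]].
  rewrite poweRyr; last by rewrite gt_eqF// (lt_le_trans e0).
  by rewrite gt0_muley ?leey// lte_fin powR_gt0// (lt_le_trans ltr01).
rewrite poweR_EFin -EFinM lee_fin.
have le_minn : \sum_(j < n) (\1_(B j) w : R) <= (minn n m)%:R.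
  apply: (@le_trans _ _ (\sum_(j < n) (j < m)%N%:R)).
    apply: ler_sum => j _; rewrite indicE; case: (boolP (w \in B j)) => //= wB.
    have := hB j w; rewrite inE in wB => /(_ wB) h.
    case: ltnP => //= mj; have := h m mj; by rewrite ltNge Zm.
  suff -> : \sum_(j < n) (j < m)%N%:R = (minn n m)%:R :> R by [].
  rewrite -natr_sum; congr (_%:R); elim: n {n0 n1} => [|l IH].
    by rewrite big_ord0 min0n.
  rewrite big_ord_recr/= IH; case: (ltnP l m) => lm.
    by rewrite addn1 (minn_idPl lm).
  by rewrite addn0 (minn_idPr (leqW lm)).
apply: (le_trans le_minn).
(* tau = 0 is set apart, since raising the exponent from e to q needs tau >= 1. *)
case: m Zm le_minn => [|m] _ _; first by rewrite minn0 mulr_ge0 ?powR_ge0.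
set l := minn n m.+1.
have l0 : (0 < l)%N by rewrite leq_min n0.
have l0R : 0 < l%:R :> R by rewrite ltr0n.
have -> : l%:R = l%:R `^ (1 - e) * l%:R `^ e :> R.
  by rewrite -powRD ?subrK ?oner_eq0// powRr1// ltW.
apply: ler_pM; rewrite ?powR_ge0//.
  by rewrite ge0_ler_powR ?nnegrE ?subr_ge0// ler_nat geq_minl.
apply: (@le_trans _ _ (m.+1%:R `^ e)).
  by rewrite ge0_ler_powR ?nnegrE ?(ltW e0)// ler_nat geq_minr.
by rewrite ler_powR// ler1n.
Qed.

End hitting_moments.

(** * Choice of the exponents and conclusion *)

Section random_walk_moments.
Context (R : realType) (alpha c : R) (v : R -> R).
Hypothesis alpha1 : 1 < alpha.
Hypothesis c0 : 0 < c.
Hypothesis hv : class_D alpha c v.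
Context (d : measure_display) (T : measurableType d) (P : probability T R).
Variables (x a : R) (Z : nat -> {RV P >-> R}).
Hypothesis hZ : random_walk (fun y => 2^-1 * v `|y|) x Z.
Hypothesis a0 : 0 < a.
Hypothesis ax : a < `|x|.

Let X (n : nat) (w : T) : R := Z n.+1 w - Z n w.

Let mX n : measurable_fun setT (X n).
Proof. exact: measurable_funB. Qed.

Let X0 : {RV P >-> R} := HB.pack (X 0%N) (isMeasurableFun.Build _ _ _ _ _ (mX 0%N)).

Let mu : probability R R := distribution P X0.

Let indX : mutually_independent P X.
Proof. by case: hZ. Qed.

Let muE (B : set R) : measurable B ->
  mu B = (\int[lebesgue_measure]_(y in B) (2^-1 * v `|y|)%:E)%E.
Proof. by move=> mB; case: hZ => _ hs _; rewrite -(hs 0%N). Qed.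

Let lawX n (B : set R) : measurable B -> P (X n @^-1` B) = mu B.
Proof. by move=> mB; rewrite muE//; case: hZ => _ hs _; rewrite -(hs n). Qed.

Let alpha0 : 0 < alpha. Proof. exact: lt_trans alpha1. Qed.

Let mu_sym (B : set R) : measurable B -> mu (-%R @^-1` B) = mu B.
Proof. exact: (step_law_symmetric hv muE). Qed.

Let walkE n w : Z 0%N w = x -> walk X x n w = Z n w.
Proof.
move=> Zx; elim: n => [|n IH]; first by rewrite /walk big_ord0 addr0.
by rewrite walkS IH /X subrKC.
Qed.

Let mwalk n : measurable_fun setT (walk X x n).
Proof. exact: measurable_walk. Qed.

(** Z starts at x only almost surely, while [walk] does so everywhere; the moment does not see the
    difference. *)
Let momentE q : hitting_moment P (fun n => Z n) a q =
  hitting_moment P (walk X x) a q.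
Proof.
have mp (Y : nat -> T -> R) : (forall n, measurable_fun setT (Y n)) ->
    measurable_fun setT (fun w => hitting_time Y a w `^ q)%E.
  move=> mY; apply: (measurableT_comp (measurable_poweR q)).
  exact: measurable_hitting_time.
rewrite /hitting_moment; apply: ae_eq_integral => //.
- by apply: (mp (fun n => Z n)) => n.
- exact: mp.
case: hZ => Z0 _ _; apply: filterS Z0 => w Zx _.
have -> // : hitting_time (fun n => Z n) a w = hitting_time (walk X x) a w.
rewrite /hitting_time; congr (ereal_inf (_ @` _)).
by apply/seteqP; split => n /=; rewrite walkE.
Qed.

(** The bound on psi is asked of every law with the step density, so it can be supplied from outside
    without naming the law of the first step. *)
Lemma hitting_moment_dichotomy (gamma : R) : 1 < gamma -> gamma <= 2 ->
  gamma <= alpha ->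
  (forall nu : probability R R,
     (forall B, measurable B ->
        nu B = (\int[lebesgue_measure]_(y in B) (2^-1 * v `|y|)%:E)%E) ->
     exists2 k : R, 0 < k &
       forall t, 0 < t -> k * Num.min t 1 `^ gamma <= one_minus_cf nu t) ->
  forall q, (q < 1 - gamma^-1 -> (hitting_moment P (fun n => Z n) a q < +oo)%E) /\
    (1 - gamma^-1 < q -> hitting_moment P (fun n => Z n) a q = +oo%E).
Proof.
move=> g1 g2 galpha /(_ mu muE)[k k0 psi_ge] q.
have g0 : 0 < gamma by exact: lt_trans g1.
have gV : gamma * gamma^-1 = 1 by rewrite divff// gt_eqF.
have gV0 : 0 < gamma^-1 by rewrite invr_gt0.
have gV1 : gamma^-1 < 1 by rewrite invf_lt1.
have psi_ge2 t : 0 < t -> k * Num.min t 1 `^ 2 <= one_minus_cf mu t.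
  move=> t0; apply: le_trans (psi_ge t t0); rewrite ler_pM2l//.
  by apply: ger_powR => //; rewrite lt_min t0 ltr01 ge_min lexx orbT.
rewrite momentE; split => qg.
  pose q' := Num.max q 0.
  have q'0 : 0 <= q' by rewrite le_max lexx orbT.
  have q'g : q' < 1 - gamma^-1 by rewrite gt_max qg subr_gt0.
  have q'1 : 0 < 1 - q' by rewrite subr_gt0 (lt_trans q'g)// gtrBl.
  (* Any b strictly between 1/(1 - q') and gamma gives q' < 1 - 1/b, the survival exponent;
     truncating q at 0 ensures b > 1. *)
  pose b := ((1 - q')^-1 + gamma) / 2.
  have qb : (1 - q')^-1 < gamma.
    by rewrite -(invrK gamma) ltf_pV2 ?posrE// ltrBrDl -ltrBrDr.
  have bg : b < gamma by rewrite /b; lra.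
  have bq : (1 - q')^-1 < b by rewrite /b; lra.
  have iq1 : 1 <= (1 - q')^-1 by rewrite invf_ge1// gerBl.
  have b1 : 1 < b by exact: le_lt_trans bq.
  have b0 : 0 < b by exact: lt_trans b1.
  have [||C C0 psi_le] := one_minus_cf_le alpha0 hv muE (b := b).
  - by rewrite (ltW b0) (lt_le_trans bg).
  - exact: le_trans (ltW bg) g2.
  have [K K0 hK] :=
    survival_le mX indX lawX mu_sym k0 psi_ge2 C0 b1 psi_le x a0.
  apply: (@hitting_moment_lty _ _ _ _ _ a mwalk K (1 - b^-1)) => //.
  - by rewrite subr_gt0 invf_lt1.
  - apply: (@le_lt_trans _ _ q'); first by rewrite le_max lexx.
    rewrite ltrBrDl -ltrBrDr -[ltRHS]invrK ltf_pV2 ?posrE ?invr_gt0//.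
  - by move=> n n0; rewrite opprB; exact: hK.
apply/eqP; rewrite -leye_eq leNgt; apply/negP => fin.
pose e := Num.min q 1.
have eg : 1 - gamma^-1 < e by rewrite lt_min qg gtrBl.
have e1 : e <= 1 by rewrite ge_min lexx orbT.
have eq : e <= q by rewrite ge_min lexx.
have e0 : 0 < e by apply: lt_trans eg; rewrite subr_gt0.
have egg : gamma - 1 < e * gamma.
  have -> : gamma - 1 = (1 - gamma^-1) * gamma by rewrite mulrBl mulVf ?gt_eqF// mul1r.
  by rewrite ltr_pM2r.
(* th < e s amounts to (1 + e) eps < e gamma - gamma + 1 = 4 eps, true as e <= 1; moreover eps <=
   1/4 keeps th < s. *)
pose eps := (e * gamma - gamma + 1) / 4.
have eps0 : 0 < eps by rewrite /eps; lra.
have eps4 : eps <= 4^-1.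
  have : e * gamma <= gamma by rewrite ler_piMl// ltW.
  by rewrite /eps; lra.
pose s := gamma - eps; pose th := gamma - 1 + eps.
have s0 : 0 < s by rewrite /s; lra.
have ths : th / s < e.
  rewrite ltr_pdivrMr// /th /s.
  have : e * eps <= eps by rewrite ler_piMl// ltW.
  rewrite mulrBr; rewrite /eps; lra.
pose b := (Num.max s 1 + gamma) / 2.
have sm : Num.max s 1 < gamma by rewrite gt_max g1 andbT /s; lra.
have ms : s <= Num.max s 1 by rewrite le_max lexx.
have m1 : 1 <= Num.max s 1 by rewrite le_max lexx orbT.
have bg : b < gamma by rewrite /b; lra.
have sb : s < b by rewrite /b; lra.
have b1 : 1 < b by rewrite /b; lra.
have [||C C0 psi_le] := one_minus_cf_le alpha0 hv muE (b := b).
- by rewrite (ltW (lt_trans ltr01 b1)) (lt_le_trans bg).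
- exact: le_trans (ltW bg) g2.
have g12 : 1 < gamma <= 2 by rewrite g1.
have th_gt : gamma - 1 < th by rewrite /th; lra.
have th_lt : th < s by rewrite /th /s; lra.
have s2 : s < 2 by rewrite /s; lra.
have [r ar hr] := survival_sum_large mX indX lawX mu_sym g12 k0 psi_ge C0 b1 psi_le
  th_gt th_lt sb s2 x a0.
have outside_a n : far_start a r n `<=` outside a.
  by move=> y; rewrite /far_start /outside/=; case: ifP => // _; exact: le_lt_trans.
have mA n : measurable (alive X x (far_start a r) n).
  by apply: measurable_alive => // j; exact: measurable_outside.
pose M := fine (hitting_moment P (walk X x) a q).
have ME : hitting_moment P (walk X x) a q = M%:E.
  by rewrite fineK// ge0_fin_numE// integral_ge0// => w _; exact: poweR_ge0.
apply: (hr _ M e ths e1).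
  have [r0 r01 [k1 k10 hk1]] := step_law_tail_ge alpha0 c0 hv muE.
  (* A first step in [r', 2r'] has positive probability by the tail bound and takes the walk from x
     beyond r. *)
  pose r' := Num.max r0 (r + `|x| + 1).
  have r0r : r0 <= r' by rewrite le_max lexx.
  have rr' : r + `|x| + 1 <= r' by rewrite le_max lexx orbT.
  have r'0 : 0 < r' by apply: lt_le_trans r0r; exact: lt_le_trans r01.
  pose B : set R := [set` `[r', r' *+ 2]].
  have mB : measurable B by exact: measurable_itv.
  apply: (@lt_le_trans _ _ (mu B)).
    apply: lt_le_trans (hk1 r' B r0r mB _) => //.
    rewrite lebesgue_measure_itv/= lte_fin mulr2n ltrDl r'0 -EFinB addrK.
    by rewrite -EFinM lte_fin !mulr_gt0// powR_gt0.
  rewrite -(lawX 0%N mB); apply: le_measure; rewrite ?inE//.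
    by rewrite -[X in measurable X]setTI; exact: mX.
  move=> w; rewrite /B/= in_itv/= => /andP[rX _] [|[|]]// _.
    by rewrite /far_start/= /outside/= /walk big_ord0 addr0.
  rewrite /far_start/= /outside/= /walk big_ord_recr big_ord0/= add0r.
  apply: lt_le_trans (ler_norm _).
  have := ler_norm (- x); rewrite normrN => xN.
  have : r + `|x| + 1 <= X 0%N w by exact: le_trans rX.
  by lra.
move=> n n0; rewrite mulrC EFinM -ME.
apply: survival_sum_le => //.
move=> j w Bw i ij; have := Bw i ij; exact: outside_a.
Qed.

End random_walk_moments.

Theorem theorem3p2 (R : realType) (alpha c : R) (v : R -> R)
    (halpha : 1 < alpha) (hc : 0 < c) (hv : class_D alpha c v)
    (d : measure_display) (T : measurableType d) (P : probability T R)
    (x a : R) (Z : nat -> {RV P >-> R})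
    (hZ : random_walk (fun y => 2^-1 * v `|y|) x Z)
    (ha : 0 < a) (hx : x \notin `[- a, a]) :
  (2 <= alpha ->
     forall q : R,
       (q < 2^-1 -> (hitting_moment P (fun n => Z n) a q < +oo)%E) /\
       (2^-1 < q -> hitting_moment P (fun n => Z n) a q = +oo%E)) /\
  (alpha < 2 ->
     forall q : R,
       (q < 1 - alpha^-1 -> (hitting_moment P (fun n => Z n) a q < +oo)%E) /\
       (1 - alpha^-1 < q -> hitting_moment P (fun n => Z n) a q = +oo%E)).
Proof.
have ax : a < `|x| by rewrite ltNge ler_norml; rewrite in_itv/= in hx.
have alpha0 : 0 < alpha by exact: lt_trans halpha.
split => [a2|a2] q.
  have -> : 2^-1 = 1 - 2^-1 :> R by lra.
  apply: (hitting_moment_dichotomy halpha hc hv hZ ha ax) => //.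
    by rewrite ltr1n.
  by move=> nu nuE; exact: (one_minus_cf_ge_sqr alpha0 hc hv nuE).
apply: (hitting_moment_dichotomy halpha hc hv hZ ha ax) => //; first exact: ltW.
by move=> nu nuE; exact: (one_minus_cf_ge_alpha alpha0 hc hv nuE).
Qed.
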